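(* Let $y=s_{i_1}s_{i_2}\cdots s_{i_n}$ be a reduced expression of an element $y\in\tilde W$, so that $\ell(y)=n>0$, and for $1\le k\leq n$ write $y_k=s_{i_1}\cdots s_{i_k}$. Then $$-q^{\frac{1-n}{2}}(\phi\circ j)^{-1}(t_y)=\sum_{k=1}^{n}q^{k-n}\left(\sum_{\substack{w\in\tilde W\\ w\text{ starts with }y_k}}\frac{(-1)^{\ell(w)}q^{-\ell(w)+1}}{1+q}T_w+\sum_{\substack{w\in\tilde W\\ w\text{ does not start with }y_k\\ \ell(w)\ge k}}\frac{(-1)^{\ell(w)+1}q^{-\ell(w)}}{1+q}T_w+\frac{(-1)^kq^{-k+1}}{1+q}\sum_{\substack{w\in\tilde W\\ w\text{ does not start with }y_k\\ \ell(w)<k}}T_w\right).$$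
   Context: $\tilde W=\langle s_0,s_1\mid s_0^2=s_1^2=1\rangle$ is the affine Weyl group of $\mathrm{SL}_2$ (the infinite dihedral group), with length function $\ell$, strong Bruhat order $\le$ and identity $1$. An element $w$ starts with $y$ if a reduced expression of $y$ is an initial segment of a reduced expression of $w$, i.e. $\ell(w)=\ell(y)+\ell(y^{-1}w)$ (the case $w=y$ is allowed). Let $q^{1/2}$ be an indeterminate and $\mathcal A=\mathbb Z[q^{1/2},q^{-1/2}]$. $H$ is the $\mathcal A$-algebra with $\mathcal A$-basis $\{T_w\}_{w\in\tilde W}$ and relations $T_wT_{w'}=T_{ww'}$ if $\ell(ww')=\ell(w)+\ell(w')$, and $(T_s+1)(T_s-q)=0$ for $s\in\{s_0,s_1\}$. The Kazhdan–Lusztig bases (all Kazhdan–Lusztig polynomials equal $1$ here) are $$C_w=\sum_{y\le w}(-1)^{\ell(w)-\ell(y)}q^{\frac{\ell(w)-\ell(y)}{2}}q^{-\frac{\ell(y)}{2}}T_y,\qquad C'_w=q^{-\frac{\ell(w)}{2}}\sum_{y\le w}T_y.$$ Let $\overline{(\,\cdot\,)}$ be the involution of $\mathcal A$ with $\overline{q^{1/2}}=q^{-1/2}$. The ring involution $j$ of $H$ is $j(\sum a_wT_w)=\sum\overline{a_w}(-1)^{\ell(w)}q^{-\ell(w)}T_w$; it satisfies $C'_w=(-1)^{\ell(w)}j(C_w)$. Define $h_{x,y,z}\in\mathcal A$ by $C_xC_y=\sum_z h_{x,y,z}C_z$. The set of distinguished involutions is $\mathcal D=\{1,s_0,s_1\}$,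 and Lusztig's $a$-function has values $a(1)=0$ and $a(w)=1$ for $w\ne1$. $J$ is Lusztig's asymptotic Hecke algebra, a $\mathbb Z$-algebra with $\mathbb Z$-basis $\{t_w\}_{w\in\tilde W}$, and $\phi\colon H\to J\otimes_{\mathbb Z}\mathcal A$ is the $\mathcal A$-algebra map with $$\phi(C_x)=\sum_{\substack{z\in\tilde W,\ d\in\mathcal D\\ a(d)=a(z)}}h_{x,d,z}\,t_z.$$ Completions: $\mathcal H$ is the set of formal sums $\sum_x b_xC_x$ with $b_x\in\mathbb Z((q^{1/2}))$ such that for every $N>0$ one has $b_x\in q^{N/2}\mathbb Z[[q^{1/2}]]$ for $\ell(x)$ sufficiently large; $\mathcal J$ is defined in the same way with $t_x$ in place of $C_x$. The map $\phi$ extends (coefficientwise) to an isomorphism $\phi\colon\mathcal H\to\mathcal J$. $\mathcal H'$ is the set of formal sums $\sum_x b_xC'_x$ with $b_x\in\mathbb Z((q^{-1/2}))$ satisfying the same condition with $q^{-1/2}$ in place of $q^{1/2}$. The involution $j$ extends to mutually inverse bijections between $\mathcal H'$ and $\mathcal H$, with $j(\sum b_xC'_x)=\sum(-1)^{\ell(x)}\overline{b_x}C_x$. Thus $(\phi\circ j)^{-1}(t_y)=j(\phi^{-1}(t_y))\in\mathcal H'$. An element $\sum_v a_vC'_v\in\mathcal H'$ is written in the $T$-basis by expanding each $C'_v$; the coefficient of $T_x$ is the convergent series $\sum_{v\ge x}a_vq^{-\ell(v)/2}\in\mathbb Z((q^{-1/2}))$. Here $\frac{q}{1+q}$ is understood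 as $\sum_{m\ge0}(-1)^mq^{-m}$. *)

(* Defs.v *)
From HB Require Import structures.
From mathcomp Require Import all_boot all_order all_algebra.
From mathcomp Require Import finmap.
From mathcomp Require Import mathcomp_extra boolp classical_sets functions.
From mathcomp Require Import cardinality fsbigop.
From mathcomp Require Import monalg.
From mathcomp Require Import ring zify.

Set Implicit Arguments.
Unset Strict Implicit.
Unset Printing Implicit Defensive.

Import Order.TTheory GRing.Theory Num.Theory.

Local Open Scope classical_set_scope.
Local Open Scope ring_scope.

(** * Laurent polynomials and Laurent series in [q^(1/2)]

    A coefficient function [f : int -> int] stands for the formal sum of the
    [f i * q^(i/2)].  The exponent [i] always refers to [q^(1/2)], also for the
    series in [q^(-1/2)]. *)

Variant shape := Finite | Ascending | Descending.

Definition bounded_below (f : int -> int) := exists N : int, forall i, i < N -> f i = 0.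
Definition bounded_above (f : int -> int) := exists N : int, forall i, N < i -> f i = 0.

Definition has_shape (k : shape) (f : int -> int) : Prop :=
  match k with
  | Finite => bounded_below f /\ bounded_above f
  | Ascending => bounded_below f
  | Descending => bounded_above f
  end.

Record laurent (k : shape) := Laurent {
  lcoef :> int -> int;
  _ : `[< has_shape k lcoef >] }.

HB.instance Definition _ k := [isSub for @lcoef k].
HB.instance Definition _ k := [Choice of laurent k by <:].

Notation LaurentPoly := (laurent Finite).      (* Z[q^(1/2), q^(-1/2)] *)
Notation SeriesUp := (laurent Ascending).      (* Z((q^(1/2))) *)
Notation SeriesDown := (laurent Descending).   (* Z((q^(-1/2))) *)

Definition mkLaurent k f (H : has_shape k f) : laurent k := Laurent (introT (asboolP _) H).

Lemma laurentP k (f : laurent k) : has_shape k f.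
Proof. by case: f => f /= /asboolP. Qed.

Lemma laurent_eqP k (f g : laurent k) : (forall i, f i = g i) -> f = g.
Proof. by move=> fg; apply/val_inj/funext. Qed.

Lemma lcoef_inj k (f g : laurent k) : lcoef f = lcoef g -> f = g.
Proof. exact: val_inj. Qed.

Section Convolution.

Implicit Types (f g h : int -> int).

Definition conv f g (n : int) : int := \sum_(i \in [set: int]) f i * g (n - i).

Definition flip f i := f (- i).

Lemma bounded_above_flip f : bounded_above f -> bounded_below (flip f).
Proof. by move=> [N fN]; exists (- N) => i iN; apply: fN; lia. Qed.

Lemma bounded_below_flip f : bounded_below f -> bounded_above (flip f).
Proof. by move=> [N fN]; exists (- N) => i iN; apply: fN; lia. Qed.

Lemma flipK f : flip (flip f) = f.
Proof. by apply/funext => i; rewrite /flip opprK. Qed.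

Lemma opp_bij : bijective (fun i : int => - i).
Proof. by exists (fun i => - i); exact: opprK. Qed.

Lemma sub_bij (n : int) : bijective (fun i : int => n - i).
Proof. by exists (fun i => n - i) => i; lia. Qed.

Lemma add_bij (n : int) : bijective (fun i : int => i + n).
Proof. by exists (fun i => i - n) => i; lia. Qed.

Lemma conv_flip f g n : conv (flip f) (flip g) n = conv f g (- n).
Proof.
rewrite /conv (reindex_fsbigT _ _ opp_bij); apply: eq_fsbigr => i _.
by rewrite /flip opprK; congr (f _ * g _); lia.
Qed.

Lemma flip_conv f g : flip (conv f g) = conv (flip f) (flip g).
Proof. by apply/funext => n; rewrite conv_flip. Qed.

Lemma convC f g : conv f g = conv g f.
Proof.
apply/funext => n; rewrite /conv (reindex_fsbigT _ _ (sub_bij n)).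
by apply: eq_fsbigr => i _; rewrite mulrC; congr (g _ * f _); lia.
Qed.

Definition window (M : nat) : seq int := [seq j%:Z - M%:Z | j <- iota 0 M.*2.+1].

Lemma window_uniq M : uniq (window M).
Proof. by rewrite map_inj_uniq ?iota_uniq // => i j; lia. Qed.

Lemma mem_window M (i : int) : (i \in window M) = (`|i| <= M%:Z).
Proof.
apply/mapP/idP => [[j]|iM]; first by rewrite mem_iota => /andP[_ jM] ->; lia.
by exists (absz (i + M%:Z)%R); [rewrite mem_iota; lia | lia].
Qed.

Lemma fsum_seq (I : choiceType) (F : I -> int) s :
  uniq s -> (forall i, F i != 0 -> i \in s) ->
  \sum_(i \in [set: I]) F i = \sum_(i <- s) F i.
Proof.
move=> us Fs; rewrite fsbig_supp; apply: fsbig_fwiden => //.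
  by move=> i [_ /= /eqP]; exact: Fs.
by move=> i [_ /= nF]; apply: contrapT => Fi; apply: nF; split.
Qed.

Lemma conv_window f g : bounded_below f -> bounded_below g -> forall n,
  exists M0 : nat, forall M m, (M0 <= M)%N -> m <= n ->
    conv f g m = \sum_(i <- window M) f i * g (m - i).
Proof.
move=> [a fa] [b gb] n; exists (absz a + absz (n - b)%R)%N => M m M0M mn.
apply: fsum_seq (window_uniq _) _ => i; rewrite mulf_eq0 negb_or => /andP[fi gi].
have ai : ~ i < a by move=> /fa fi0; rewrite fi0 eqxx in fi.
have bi : ~ m - i < b by move=> /gb gi0; rewrite gi0 eqxx in gi.
by rewrite mem_window; lia.
Qed.

Lemma conv_below f g : bounded_below f -> bounded_below g -> bounded_below (conv f g).
Proof.
move=> [a fa] [b gb]; exists (a + b) => n nab; apply: fsbig1 => i _.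
have [/fa ->|ai] := ltP i a; first by rewrite mul0r.
by rewrite gb ?mulr0 //; lia.
Qed.

Lemma convDl_below f g h : bounded_below f -> bounded_below g -> bounded_below h ->
  conv (f + g) h = conv f h + conv g h.
Proof.
move=> bf bg bh; apply/funext => n.
have bfg : bounded_below (f + g).
  by case: bf bg => [a fa] [b gb]; exists (Num.min a b) => i iab;
     rewrite fctE fa ?gb ?addr0 //; lia.
have [M1 E1] := conv_window bf bh n; have [M2 E2] := conv_window bg bh n.
have [M3 E3] := conv_window bfg bh n; pose M := (M1 + M2 + M3)%N.
rewrite -[RHS]/(conv f h n + conv g h n) (E1 M) ?(E2 M) ?(E3 M) ?/M; try lia.
by rewrite -big_split; apply: eq_bigr => i _; rewrite fctE mulrDl.
Qed.

Lemma convA_below f g h : bounded_below f -> bounded_below g -> bounded_below h ->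
  conv f (conv g h) = conv (conv f g) h.
Proof.
move=> bf bg bh; apply/funext => n; have [c hc] := bh.
have bfg := conv_below bf bg; have bgh := conv_below bg bh.
have [M1 E1] := conv_window bf bgh n; have [M2 E2] := conv_window bfg bh n.
have [M3 E3] := conv_window bf bg (n - c).
have [a fa] := bf; have [b gb] := bg.
pose M := (M1 + M2 + M3 + absz (n - c)%R + absz (a + b)%R)%N.
rewrite (E1 M) ?(E2 M) ?/M; try lia; rewrite -/M.
have El i : f i * conv g h (n - i) =
    \sum_(j <- window M) f i * g (j - i) * h (n - j).
  have [->|fi] := eqVneq (f i) 0.
    by rewrite mul0r big1 // => j _; rewrite !mul0r.
  have ai : ~ i < a by move=> /fa fi0; rewrite fi0 eqxx in fi.
  under eq_bigr do rewrite -mulrA.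
  rewrite -mulr_sumr; congr (_ * _).
  rewrite /conv (reindex_fsbigT _ _ (add_bij (- i))) /=.
  under eq_fsbigr do rewrite opprB addrA subrK.
  apply: fsum_seq (window_uniq _) _ => j.
  rewrite mulf_eq0 negb_or => /andP[gj hj].
  have bj : ~ j - i < b by move=> /gb gj0; rewrite gj0 eqxx in gj.
  have cj : ~ n - j < c by move=> /hc hj0; rewrite hj0 eqxx in hj.
  by rewrite mem_window /M; lia.
have Er j : conv f g j * h (n - j) =
    \sum_(i <- window M) f i * g (j - i) * h (n - j).
  have [->|hj] := eqVneq (h (n - j)) 0.
    by rewrite mulr0 big1 // => i _; rewrite mulr0.
  have cj : ~ n - j < c by move=> /hc hj0; rewrite hj0 eqxx in hj.
  by rewrite (E3 M) ?/M -?mulr_suml //; lia.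
under eq_bigr do rewrite El.
by rewrite exchange_big; apply: eq_bigr => j _; rewrite Er.
Qed.

Definition mono (n : int) (i : int) : int := (i == n)%:R.

Lemma mono_below n : bounded_below (mono n).
Proof. by exists n => i ni; rewrite /mono lt_eqF. Qed.

Lemma mono_above n : bounded_above (mono n).
Proof. by exists n => i ni; rewrite /mono gt_eqF. Qed.

Lemma conv_mono n f m : conv (mono n) f m = f (m - n).
Proof.
rewrite /conv (@fsum_seq _ _ [:: n]) // => [|i].
  by rewrite big_seq1 /mono eqxx mul1r.
by rewrite /mono mem_seq1; case: (i == n) => //; rewrite mul0r eqxx.
Qed.

Lemma add_below f g : bounded_below f -> bounded_below g -> bounded_below (f + g).
Proof.
move=> [a fa] [b gb]; exists (Num.min a b) => i iab.
by rewrite fctE fa ?gb ?addr0 //; lia.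
Qed.

Lemma opp_below f : bounded_below f -> bounded_below (- f).
Proof. by move=> [a fa]; exists a => i ia; rewrite fctE fa ?oppr0. Qed.

Lemma add_above f g : bounded_above f -> bounded_above g -> bounded_above (f + g).
Proof.
move=> [a fa] [b gb]; exists (Num.max a b) => i iab.
by rewrite fctE fa ?gb ?addr0 //; lia.
Qed.

Lemma opp_above f : bounded_above f -> bounded_above (- f).
Proof. by move=> [a fa]; exists a => i ia; rewrite fctE fa ?oppr0. Qed.

Lemma conv_above f g : bounded_above f -> bounded_above g -> bounded_above (conv f g).
Proof.
move=> /bounded_above_flip bf /bounded_above_flip bg.
by rewrite -[conv f g]flipK flip_conv; apply/bounded_below_flip/conv_below.
Qed.

Variable k : shape.

Lemma shape_add f g : has_shape k f -> has_shape k g -> has_shape k (f + g).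
Proof.
case: k => [[? ?] [? ?]| |] /=; [split| |].
all: by [exact: add_below | exact: add_above].
Qed.

Lemma shape_opp f : has_shape k f -> has_shape k (- f).
Proof.
case: k => [[? ?]| |] /=; [split| |].
all: by [exact: opp_below | exact: opp_above].
Qed.

Lemma shape_mono n : has_shape k (mono n).
Proof. by case: k => /=; [split| |]; do ?[exact: mono_below|exact: mono_above]. Qed.

Lemma shape_zero : has_shape k 0.
Proof. by case: k => /=; [split| |]; exists 0. Qed.

Lemma shape_conv f g : has_shape k f -> has_shape k g -> has_shape k (conv f g).
Proof.
case: k => [[? ?] [? ?]| |] /=; [split| |].
all: by [exact: conv_below | exact: conv_above].
Qed.

Lemma shape_cases f : has_shape k f ->
  if k is Descending then bounded_below (flip f) else bounded_below f.
Proof. by case: k => // [[]|/bounded_above_flip]. Qed.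

Lemma convA f g h : has_shape k f -> has_shape k g -> has_shape k h ->
  conv f (conv g h) = conv (conv f g) h.
Proof.
move=> /shape_cases + /shape_cases + /shape_cases.
case: k; [exact: convA_below | exact: convA_below | move=> bf bg bh].
by apply: (can_inj flipK); rewrite !flip_conv convA_below.
Qed.

Lemma convDl f g h : has_shape k f -> has_shape k g -> has_shape k h ->
  conv (f + g) h = conv f h + conv g h.
Proof.
move=> /shape_cases + /shape_cases + /shape_cases.
case: k; [exact: convDl_below | exact: convDl_below | move=> bf bg bh].
have flipD u v : flip (u + v) = flip u + flip v by [].
by apply: (can_inj flipK); rewrite flip_conv !flipD !flip_conv convDl_below.
Qed.

End Convolution.

Definition laurent_zero k : laurent k := mkLaurent (shape_zero k).

HB.lock Definition laurent_opp k (f : laurent k) : laurent k :=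
  mkLaurent (shape_opp (laurentP f)).

HB.lock Definition laurent_add k (f g : laurent k) : laurent k :=
  mkLaurent (shape_add (laurentP f) (laurentP g)).

HB.lock Definition laurent_mul k (f g : laurent k) : laurent k :=
  mkLaurent (shape_conv (laurentP f) (laurentP g)).

(* the monomial [q^(n/2)] *)
HB.lock Definition qh k (n : int) : laurent k := mkLaurent (shape_mono k n).

Section LaurentRing.

Variable k : shape.
Implicit Types f g h : laurent k.

Let addE f g : lcoef (laurent_add f g) = lcoef f + lcoef g.
Proof. by rewrite laurent_add.unlock. Qed.
Let oppE f : lcoef (laurent_opp f) = - lcoef f.
Proof. by rewrite laurent_opp.unlock. Qed.
Let mulE f g : lcoef (laurent_mul f g) = conv f g.
Proof. by rewrite laurent_mul.unlock. Qed.
Let qhE n : lcoef (qh k n) = mono n.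
Proof. by rewrite qh.unlock. Qed.

Fact laurent_addA : associative (@laurent_add k).
Proof. by move=> f g h; apply: lcoef_inj; rewrite !addE addrA. Qed.
Fact laurent_addC : commutative (@laurent_add k).
Proof. by move=> f g; apply: lcoef_inj; rewrite !addE addrC. Qed.
Fact laurent_add0 : left_id (laurent_zero k) (@laurent_add k).
Proof. by move=> f; apply: lcoef_inj; rewrite !addE add0r. Qed.
Fact laurent_addN : left_inverse (laurent_zero k) (@laurent_opp k) (@laurent_add k).
Proof. by move=> f; apply: lcoef_inj; rewrite !addE oppE addNr. Qed.

HB.instance Definition _ := GRing.isZmodule.Build (laurent k)
  laurent_addA laurent_addC laurent_add0 laurent_addN.

Fact laurent_mulA : associative (@laurent_mul k).
Proof.
move=> f g h; apply: lcoef_inj; rewrite !mulE.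
by apply: (@convA k); exact: laurentP.
Qed.
Fact laurent_mulC : commutative (@laurent_mul k).
Proof. by move=> f g; apply: lcoef_inj; rewrite !mulE convC. Qed.
Fact laurent_mul1 : left_id (qh k 0) (@laurent_mul k).
Proof.
move=> f; apply: laurent_eqP => i.
by rewrite mulE qhE conv_mono subr0.
Qed.
Fact laurent_mulDl : left_distributive (@laurent_mul k) +%R.
Proof.
move=> f g h; apply: lcoef_inj; rewrite addE !mulE addE.
by apply: (@convDl k); exact: laurentP.
Qed.
Fact laurent_1_neq0 : qh k 0 != 0.
Proof.
apply/eqP => /(congr1 (fun f : laurent k => f 0)).
by rewrite qhE.
Qed.

HB.instance Definition _ := GRing.Zmodule_isComNzRing.Build (laurent k)
  laurent_mulA laurent_mulC laurent_mul1 laurent_mulDl laurent_1_neq0.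

Lemma lcoef0 i : (0 : laurent k) i = 0. Proof. by []. Qed.

Lemma lcoefD f g i : (f + g) i = f i + g i.
Proof. by rewrite addE. Qed.

Lemma lcoefN f i : (- f) i = - f i.
Proof. by rewrite oppE. Qed.

Lemma lcoefM f g i : (f * g) i = conv f g i.
Proof. by rewrite mulE. Qed.

Lemma lcoef_qh n i : (qh k n) i = (i == n)%:R.
Proof. by rewrite qhE. Qed.

Lemma lcoef_qhM n f i : (qh k n * f) i = f (i - n).
Proof. by rewrite lcoefM qhE conv_mono. Qed.

Lemma lcoef_signM m f i : ((-1) ^+ m * f) i = (-1) ^+ m * f i.
Proof.
elim: m i => [|m IH] i; first by rewrite !expr0 !mul1r.
by rewrite !exprS -!mulrA !mulN1r lcoefN IH.
Qed.

Lemma qh0 : qh k 0 = 1. Proof. by []. Qed.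

Lemma qhD m n : qh k (m + n) = qh k m * qh k n.
Proof.
apply: laurent_eqP => i; rewrite lcoef_qhM !lcoef_qh.
by congr (_ : bool)%:R; lia.
Qed.

End LaurentRing.

Arguments qh {k} n.

(** Involution [q^(1/2) |-> q^(-1/2)]. *)

Definition dual_shape (k : shape) : shape :=
  match k with
  | Finite => Finite
  | Ascending => Descending
  | Descending => Ascending
  end.

Lemma shape_flip k f : has_shape k f -> has_shape (dual_shape k) (flip f).
Proof.
case: k => [[? ?]| |] /=; [split| |].
all: by [exact: bounded_above_flip | exact: bounded_below_flip].
Qed.

Definition bar k (f : laurent k) : laurent (dual_shape k) :=
  mkLaurent (shape_flip (laurentP f)).

Lemma shape_of_finite k f : has_shape Finite f -> has_shape k f.
Proof. by case=> ? ?; case: k. Qed.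

(* [Z[q^(1/2), q^(-1/2)]] inside each of the rings of series *)
Definition of_poly k (f : LaurentPoly) : laurent k :=
  mkLaurent (shape_of_finite k (laurentP f)).

(** Sum of a family such that every power of [q^(1/2)] occurs in only finitely
    many members; the value is the junk [0] if the family of coefficientwise
    sums is not in [laurent k]. *)
Definition lsum k (I : choiceType) (F : I -> laurent k) : laurent k :=
  insubd (0 : laurent k) (fun n : int => \sum_(i \in [set: I]) F i n).

(* [q / (1 + q)], expanded as the sum of the [(-1)^m q^(-m)] *)
Definition q_over_1Dq : SeriesDown :=
  lsum (fun m : nat => (-1) ^+ m * qh (- (2 * m%:Z))).

Definition over_1Dq (f : SeriesDown) : SeriesDown := f * qh (- 2) * q_over_1Dq.

Lemma q_over_1DqE (i : int) :
  q_over_1Dq i = if (i <= 0) && ~~ odd (absz i) then (-1) ^+ (absz i)./2 else 0.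
Proof.
pose g (i : int) : int :=
  if (i <= 0) && ~~ odd (absz i) then (-1) ^+ (absz i)./2 else 0.
have gE : (fun n : int =>
    \sum_(m \in [set: nat]) ((-1) ^+ m * qh (- (2 * m%:Z)) : SeriesDown) n) = g.
  apply/funext => n; rewrite /g; case: ifPn => [/andP[n0 en]|nN].
    have nE : n = - (2 * ((absz n)./2)%:Z) by lia.
    rewrite (@fsum_seq _ _ [:: (absz n)./2]) // => [|m].
      by rewrite big_seq1 lcoef_signM lcoef_qh -nE eqxx mulr1.
    rewrite lcoef_signM lcoef_qh mem_seq1; case: (n =P _) => [nm _|_]; first by lia.
    by rewrite mulr0 eqxx.
  apply: fsbig1 => m _; rewrite lcoef_signM lcoef_qh.
  by case: eqP => [nm|]; [move: nN; lia | rewrite mulr0].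
rewrite /q_over_1Dq /lsum gE val_insubd asboolT //.
by exists 0 => j j0; rewrite /g leNgt j0.
Qed.

Lemma over_1DqK f : (1 + qh 2) * over_1Dq f = f.
Proof.
suff E : (1 + qh 2) * (qh (- 2) * q_over_1Dq) = 1 :> SeriesDown.
  by rewrite /over_1Dq -mulrA mulrCA E mulr1.
apply: laurent_eqP => i.
rewrite mulrDl mul1r mulrA -qhD subrr mul1r lcoefD lcoef_qhM !q_over_1DqE -qh0 lcoef_qh.
have [->|i0] := eqVneq i 0; first by [].
case: ifPn => [/andP[iA iB]|iN]; case: ifPn => [/andP[jA jB]|jN]; try by exfalso; lia.
  have -> : (absz i)./2 = (absz (i - - 2)%R)./2.+1 by lia.
  by rewrite exprS mulN1r addrN.
by [].
Qed.

(** * The infinite dihedral group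

    As the free product of two groups of order 2, it consists of the words in
    [s_0] (= [false]) and [s_1] (= [true]) without two equal adjacent letters;
    these are the unique reduced expressions of its elements. *)

Definition alternating (w : seq bool) := sorted (fun a b => a != b) w.

Record dihedral := Dihedral { word :> seq bool; _ : alternating word }.

HB.instance Definition _ := [isSub for word].
HB.instance Definition _ := [Choice of dihedral by <:].

Notation W := dihedral.

Lemma wordP (w : W) : alternating w. Proof. by case: w. Qed.

Definition lact (b : bool) (w : seq bool) : seq bool :=
  if w is c :: w' then if b == c then w' else b :: w else [:: b].

Lemma alternating_lact b w : alternating w -> alternating (lact b w).
Proof.
case: w => //= c w cw; case: eqVneq => [_|bc]; first exact: path_sorted cw.
by rewrite /alternating /= bc.
Qed.

Lemma alternating_foldr x w : alternating w -> alternating (foldr lact w x).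
Proof. by move=> rw; elim: x => //= b x; exact: alternating_lact. Qed.

Lemma lactK b w : alternating w -> lact b (lact b w) = w.
Proof.
case: w => [|c w] /=; rewrite ?eqxx // => cw.
case: eqVneq => [->|bc]; last by rewrite /= eqxx.
by case: w cw => //= d w /andP[/negbTE cd _]; rewrite cd.
Qed.

Lemma foldr_lact b u w : alternating w ->
  foldr lact w (lact b u) = lact b (foldr lact w u).
Proof.
move=> rw; case: u => //= c u; case: eqVneq => //= ->.
by rewrite lactK //; exact: alternating_foldr.
Qed.

Definition dihedral_one : W := @Dihedral [::] isT.
Definition dihedral_mul (x y : W) : W := Dihedral (alternating_foldr x (wordP y)).

Lemma alternating_rev w : alternating w -> alternating (rev w).
Proof.
by rewrite /alternating rev_sorted; under eq_sorted => a b do rewrite eq_sym.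
Qed.

Definition dihedral_inv (x : W) : W := Dihedral (alternating_rev (wordP x)).

Fact dihedral_mulA : associative dihedral_mul.
Proof.
move=> x y z; apply: val_inj => /=; elim: (val x) => //= b u ->.
by rewrite foldr_lact //; exact: wordP.
Qed.

Fact dihedral_mul1 : left_id dihedral_one dihedral_mul.
Proof. by move=> x; apply: val_inj. Qed.

Lemma foldr_lact_nil w : alternating w -> foldr lact [::] w = w.
Proof.
elim: w => //= b w IH bw; rewrite IH; last exact: path_sorted bw.
by case: w bw {IH} => //= c w /andP[/negbTE ->].
Qed.

Fact dihedral_mul1r : right_id dihedral_one dihedral_mul.
Proof. by move=> x; apply: val_inj; exact/foldr_lact_nil/wordP. Qed.

Lemma foldr_lact_rev w x : alternating x ->
  foldr lact (foldr lact x w) (rev w) = x.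
Proof.
move=> rx; elim: w => //= b w IH; rewrite rev_cons foldr_rcons lactK //.
exact: alternating_foldr.
Qed.

Fact dihedral_mulV : left_inverse dihedral_one dihedral_inv dihedral_mul.
Proof.
move=> x; apply: val_inj => /=.
by rewrite -[X in foldr _ X]foldr_lact_nil ?foldr_lact_rev //; exact: wordP.
Qed.

Fact dihedral_mulVr : right_inverse dihedral_one dihedral_inv dihedral_mul.
Proof.
have invK x : dihedral_inv (dihedral_inv x) = x by apply: val_inj; exact: revK.
by move=> x; rewrite -{1}[x]invK dihedral_mulV.
Qed.

HB.instance Definition _ := isGroup.Build W
  dihedral_mulA dihedral_mul1 dihedral_mul1r dihedral_mulV dihedral_mulVr.

Definition gen (b : bool) : W := @Dihedral [:: b] isT.
Notation s0 := (gen false).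
Notation s1 := (gen true).

Definition ell (w : W) : nat := size w.

Definition starts_with (w y : W) : bool := ell w == (ell y + ell (y^-1 * w)%g)%N.

Definition reflection (t : W) : Prop := exists x b, t = (x * gen b * x^-1)%g.

(* strong Bruhat order *)
Inductive bruhat (x : W) : W -> Prop :=
| Bruhat_refl : bruhat x x
| Bruhat_step y t of bruhat x y & reflection t & (ell y < ell (y * t)%g)%N :
    bruhat x (y * t)%g.

Definition prod_gen (i : seq bool) : W := (\prod_(b <- i) gen b)%g.

Lemma size_lact b w : odd (size (lact b w)) = ~~ odd (size w).
Proof. by case: w => //= c w; case: eqP => //=; rewrite negbK. Qed.

Lemma odd_ellM (x y : W) : odd (ell (x * y)%g) = odd (ell x) (+) odd (ell y).
Proof.
rewrite /ell /=; elim: (val x) => //= b u IH.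
by rewrite size_lact IH addNb.
Qed.

Lemma ellV (x : W) : ell x^-1%g = ell x.
Proof. exact: size_rev. Qed.

Lemma alternating_inj b u v : alternating (b :: u) -> alternating (b :: v) ->
  size u = size v -> u = v.
Proof.
elim: u v b => [|c u IH] [|d v] b //= /andP[bc cu] /andP[bd dv] [uv].
have cd : c = d by case: b c d bc bd {cu dv} => [] [] [].
by rewrite -cd in dv *; congr (_ :: _); exact: (IH v c cu dv uv).
Qed.

Lemma foldr_lact_cat u v : alternating (u ++ v) -> foldr lact v u = u ++ v.
Proof.
elim: u => //= b u IH buv; rewrite IH; last exact: path_sorted buv.
by case: (u ++ v) buv => //= c w /andP[/negbTE ->].
Qed.

Lemma palindrome_reflection (t x : W) c :
  val t = x ++ c :: rev x -> t = (x * gen c * x^-1)%g.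
Proof.
move=> tE; have tA := wordP t; rewrite /= in tE; rewrite tE in tA.
apply: val_inj; rewrite -mulgA /= tE -foldr_lact_cat //; congr foldr.
apply/esym/(@foldr_lact_cat [:: c]).
by move: tA => /cat_sorted2[].
Qed.

Lemma odd_reflection (t : W) : odd (ell t) -> reflection t.
Proof.
rewrite /ell => tO; set m := (size t)./2; set u := take m t.
have su : size u = m by rewrite size_take_min /m; lia.
have : size (drop m t) = m.+1 by rewrite size_drop /m; lia.
have tE := cat_take_drop m t; rewrite -/u in tE.
have tA := wordP t; rewrite -tE in tA.
case: (drop m t) tE tA => // c v tE tA [sv].
have uA : alternating (c :: rev u).
  rewrite -rev_rcons; apply: alternating_rev.
  by move: tA; rewrite -cat_rcons => /cat_sorted2[].
have vA : alternating (c :: v) by move: tA => /cat_sorted2[].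
have vE : v = rev u.
  by apply: alternating_inj vA uA _; rewrite size_rev sv su.
have xA : alternating u by move: tA => /cat_sorted2[].
exists (Dihedral xA), c; apply: palindrome_reflection.
by rewrite /= -tE vE.
Qed.

Lemma bruhatP (x y : W) : bruhat x y <-> x = y \/ (ell x < ell y)%N.
Proof.
have step (u v : W) : bruhat x u -> (ell u < ell v)%N ->
    odd (ell u) != odd (ell v) -> bruhat x v.
  move=> xu uv odduv; rewrite -[v](mulVKg u); apply: Bruhat_step => //.
    by apply: odd_reflection; rewrite odd_ellM ellV -negb_eqb.
  by rewrite mulVKg.
split=> [|[->|xy]]; last 1 first.
- have [xyo|] := boolP (odd (ell x) != odd (ell y)).
    by apply: step xyo => //; exact: Bruhat_refl.
  rewrite negbK => /eqP xyo.
  pose z : W := (x * gen (last false x == false))%g.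
  have zE : val z = rcons x (last false x == false).
    rewrite /= foldr_lact_cat ?cats1 //.
    have := wordP x; rewrite /alternating; case: (word x) => //= b w bw.
    by rewrite rcons_path bw; case: last.
  have zl : ell z = (ell x).+1 by rewrite /ell; move: zE => /= ->; rewrite size_rcons.
  apply: (step z); rewrite ?zl /=.
  + by apply: (step x); rewrite ?zl //=; [exact: Bruhat_refl | case: odd].
  + by rewrite ltn_neqAle xy andbT; apply/eqP => zy; move: xyo; rewrite -zy /=; case: odd.
  + by rewrite xyo; case: odd.
- by elim=> [|u t _ [<-|xu] _ ut]; [left | right | right; exact: ltn_trans ut].
- exact: Bruhat_refl.
Qed.

Lemma ell_eq0 (w : W) : (ell w == 0)%N = (w == 1%g).
Proof. exact: size_eq0. Qed.

Lemma prod_gen_word (w : W) : prod_gen w = w.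
Proof.
apply: val_inj; rewrite /prod_gen /=; have := wordP w; rewrite -/(val w).
elim: (val w) => [_|b u IH bu]; first by rewrite big_nil.
rewrite big_cons /= IH; last exact: path_sorted bu.
exact: (@foldr_lact_cat [:: b]).
Qed.

Lemma ell_prod_gen i : (ell (prod_gen i) <= size i)%N.
Proof.
rewrite /prod_gen; elim: i => [|b i IH]; first by rewrite big_nil.
rewrite big_cons /=; apply: leq_trans (_ : (ell (\prod_(c <- i) gen c)%g).+1 <= _)%N => //.
rewrite /ell /=; case: (word _) => //= c u; case: eqP => //= _.
exact: leq_trans (leqnSn _) (leqnSn _).
Qed.

Lemma finite_ell n : finite_set [set w : W | (ell w < n)%N].
Proof.
apply: (@sub_finite_set _ _ (\bigcup_(m in `I_n)
   [set prod_gen (val i) | i in [set: m.-tuple bool]])).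
  move=> w wn; exists (ell w) => //=.
  exists (@Tuple _ bool (val w) (eqxx _)) => //=; exact: prod_gen_word.
apply: bigcup_finite; first exact: finite_II.
by move=> m _; apply: finite_image; exact: finite_finset.
Qed.

Lemma finite_bruhat (w : W) : finite_set [set y | bruhat y w].
Proof.
apply: sub_finite_set (finite_ell (ell w).+1) => y /= /bruhatP[->|]//.
by rewrite ltnS => /ltnW.
Qed.

(** * The Hecke algebra *)

Definition hecke := {malg LaurentPoly[W]}.

HB.instance Definition _ := Choice.on hecke.

(* The module operations are those of [{malg _[_]}], sealed to keep them from
   being unfolded by unification. *)
HB.lock Definition hecke_add (f g : hecke) : hecke := fgadd f g.
HB.lock Definition hecke_opp (f : hecke) : hecke := fgopp f.
HB.lock Definition hecke_scale (c : LaurentPoly) (f : hecke) : hecke := fgscale c f.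
Definition hecke_zero : hecke := fgzero W LaurentPoly.

Lemma heckeP (f g : hecke) : (forall w, f@_w = g@_w) -> f = g.
Proof. by move=> /malgP. Qed.

Section HeckeModule.

Implicit Types (f g h : hecke) (c d : LaurentPoly).

Let addE f g w : (hecke_add f g)@_w = f@_w + g@_w.
Proof. by rewrite hecke_add.unlock fgaddE. Qed.
Let oppE f w : (hecke_opp f)@_w = - f@_w.
Proof. by rewrite hecke_opp.unlock fgoppE. Qed.
Let scaleE c f w : (hecke_scale c f)@_w = c * f@_w.
Proof. by rewrite hecke_scale.unlock fgscaleE. Qed.
Let zeroE w : hecke_zero@_w = 0.
Proof. exact: fgzeroE. Qed.

Fact hecke_addA : associative hecke_add.
Proof. by move=> f g h; apply: heckeP => w; rewrite !addE addrA. Qed.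
Fact hecke_addC : commutative hecke_add.
Proof. by move=> f g; apply: heckeP => w; rewrite !addE addrC. Qed.
Fact hecke_add0 : left_id hecke_zero hecke_add.
Proof. by move=> f; apply: heckeP => w; rewrite addE zeroE add0r. Qed.
Fact hecke_addN : left_inverse hecke_zero hecke_opp hecke_add.
Proof. by move=> f; apply: heckeP => w; rewrite addE oppE zeroE addNr. Qed.

HB.instance Definition _ := GRing.isZmodule.Build hecke
  hecke_addA hecke_addC hecke_add0 hecke_addN.

Fact hecke_scaleA c d f : hecke_scale c (hecke_scale d f) = hecke_scale (c * d) f.
Proof. by apply: heckeP => w; rewrite !scaleE mulrA. Qed.
Fact hecke_scale1 : left_id 1 hecke_scale.
Proof. by move=> f; apply: heckeP => w; rewrite scaleE mul1r. Qed.
Fact hecke_scaleDr : right_distributive hecke_scale +%R.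
Proof. by move=> c f g; apply: heckeP => w; rewrite !(scaleE, addE) mulrDr. Qed.
Fact hecke_scaleDl f : {morph hecke_scale^~ f : c d / c + d}.
Proof. by move=> c d; apply: heckeP => w; rewrite !(scaleE, addE) mulrDl. Qed.

HB.instance Definition _ := GRing.Zmodule_isLmodule.Build LaurentPoly hecke
  hecke_scaleA hecke_scale1 hecke_scaleDr hecke_scaleDl.

Lemma coef0 w : (0 : hecke)@_w = 0. Proof. exact: zeroE. Qed.
Lemma coefD f g w : (f + g)@_w = f@_w + g@_w. Proof. exact: addE. Qed.
Lemma coefZ c f w : (c *: f)@_w = c * f@_w. Proof. exact: scaleE. Qed.
Lemma coef_sum I (r : seq I) (F : I -> hecke) w :
  (\sum_(i <- r) F i)@_w = \sum_(i <- r) (F i)@_w.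
Proof. exact: (big_morph (fun f : hecke => f@_w) (fun f g => coefD f g w) (coef0 w)). Qed.

Lemma suppD f g : (msupp (f + g) `<=` msupp f `|` msupp g)%fset.
Proof.
apply/fsubsetP => w; rewrite in_fsetU -!mcoeff_neq0 coefD.
by apply: contraNT; rewrite negb_or !negbK => /andP[/eqP-> /eqP->]; rewrite addr0.
Qed.

Lemma suppZ c f : (msupp (c *: f) `<=` msupp f)%fset.
Proof.
apply/fsubsetP => w; rewrite -!mcoeff_neq0 coefZ.
by apply: contraNN => /eqP ->; rewrite mulr0.
Qed.

End HeckeModule.

HB.lock Definition T (w : W) : hecke := << w >>.

HB.lock Definition linext (phi : W -> hecke) (f : hecke) : hecke :=
  \sum_(w <- msupp f) f@_w *: phi w.

Lemma linextE phi f : linext phi f = \sum_(w <- msupp f) f@_w *: phi w.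
Proof. by rewrite linext.unlock. Qed.

Lemma coefT u w : (T u)@_w = (u == w)%:R.
Proof. by rewrite T.unlock mcoeffU. Qed.

Section LinearExtension.

Variable phi : W -> hecke.
Implicit Types (f g : hecke) (c : LaurentPoly).

Lemma linextw (d : {fset W}) f : (msupp f `<=` d)%fset ->
  linext phi f = \sum_(w <- d) f@_w *: phi w.
Proof.
by move=> fd; rewrite linextE; apply: big_fset_incl fd _ => w _ /mcoeff_outdom ->; rewrite scale0r.
Qed.

Lemma linextD f g : linext phi (f + g) = linext phi f + linext phi g.
Proof.
rewrite (linextw (suppD f g)) (linextw (fsubsetUl (msupp f) (msupp g))).
rewrite (linextw (fsubsetUr (msupp f) (msupp g))) -big_split.
by apply: eq_bigr => w _; rewrite coefD scalerDl.
Qed.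

Lemma linextZ c f : linext phi (c *: f) = c *: linext phi f.
Proof.
rewrite (linextw (suppZ c f)) linextE scaler_sumr.
by apply: eq_bigr => w _; rewrite coefZ scalerA.
Qed.

Lemma linext0 : linext phi 0 = 0.
Proof. by rewrite -[in LHS](scale0r (0 : hecke)) linextZ scale0r. Qed.

Lemma linext_sum I (r : seq I) (F : I -> hecke) :
  linext phi (\sum_(i <- r) F i) = \sum_(i <- r) linext phi (F i).
Proof. exact: (big_morph (linext phi) linextD linext0). Qed.

Lemma linextT w : linext phi (T w) = phi w.
Proof. by rewrite linextE T.unlock msuppU oner_eq0 big_seq_fset1 mcoeffUU scale1r. Qed.

End LinearExtension.

Lemma linext_id f : linext T f = f.
Proof.
apply: heckeP => u; rewrite linextE coef_sum [f in RHS]monalgE raddf_sum /=.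
by apply: eq_bigr => w _; rewrite coefZ coefT mcoeffU mulr_natr.
Qed.

Definition linear_map (F : hecke -> hecke) :=
  {morph F : g h / g + h} /\ (forall c g, F (c *: g) = c *: F g).

Lemma linear_map_ext (F G : hecke -> hecke) : linear_map F -> linear_map G ->
  (forall w, F (T w) = G (T w)) -> F =1 G.
Proof.
have mapE H f : linear_map H -> H f = \sum_(w <- msupp f) f@_w *: H (T w).
  move=> [HD HZ]; have H0 : H 0 = 0.
    by rewrite -[in LHS](scale0r (0 : hecke)) HZ scale0r.
  rewrite -{1}(linext_id f) linextE (big_morph H HD H0).
  by apply: eq_bigr => w _; rewrite HZ.
move=> lF lG FG f; rewrite (mapE _ _ lF) (mapE _ _ lG).
by apply: eq_bigr => w _; rewrite FG.
Qed.

Lemma linext_map phi : linear_map (linext phi).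
Proof. by split; [exact: linextD | exact: linextZ]. Qed.

Local Notation q := (qh 2 : LaurentPoly).

(* [T_s T_w], and its linear extension [T_s f], for [s = gen b] *)
Definition mulTs (b : bool) (w : W) : hecke :=
  if (ell w < ell (gen b * w)%g)%N then T (gen b * w)%g
  else (q - 1) *: T w + q *: T (gen b * w)%g.

Definition mulTsl (b : bool) (f : hecke) : hecke := linext (mulTs b) f.

Definition hecke_mul (f g : hecke) : hecke :=
  linext (fun w : W => foldr mulTsl g w) f.

Definition hecke_one : hecke := T 1%g.

Lemma ell_gen b w : ell (gen b * w)%g = if (val w) is c :: w' then
  if b == c then size w' else (ell w).+1 else 1%N.
Proof. by rewrite /ell /=; case: (val w) => //= c u; case: eqP. Qed.

Lemma genK b : (gen b * gen b)%g = 1%g.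
Proof. by apply: val_inj; rewrite /= eqxx. Qed.

Lemma gen_mulK b w : (gen b * (gen b * w))%g = w.
Proof. by rewrite mulgA genK mul1g. Qed.

Lemma ell_gen_neq b w : ell (gen b * w)%g != ell w.
Proof.
apply/eqP => E; have := odd_ellM (gen b) w.
by rewrite E /=; case: odd.
Qed.

Lemma mulTsl_quad b f : mulTsl b (mulTsl b f) = (q - 1) *: mulTsl b f + q *: f.
Proof.
move: f; apply: linear_map_ext => [||w].
- by split=> [f g|c f]; rewrite /mulTsl ?linextD ?linextZ.
- split=> [f g|c f]; rewrite /mulTsl ?linextD ?linextZ !scalerDr.
    exact: addrACA.
  by rewrite !scalerA (mulrC c (q - 1)) (mulrC c q).
rewrite /mulTsl linextT {2 3}/mulTs; have := ell_gen_neq b w; rewrite neq_ltn orbC.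
case: ltnP => [lt _|ge /= gt].
  by rewrite linextT /mulTs gen_mulK [X in if X then _ else _]ltnNge ltnW.
have ltF : (ell w < ell (gen b * w)%g)%N = false by rewrite ltnNge ge.
by rewrite linextD !linextZ !linextT /mulTs gen_mulK gt ltF.
Qed.

Lemma foldr_linextD (w : seq bool) f g :
  foldr mulTsl (f + g) w = foldr mulTsl f w + foldr mulTsl g w.
Proof. by elim: w => //= b w ->; exact: linextD. Qed.

Lemma foldr_linextZ (w : seq bool) c f :
  foldr mulTsl (c *: f) w = c *: foldr mulTsl f w.
Proof. by elim: w => //= b w ->; exact: linextZ. Qed.

Fact hecke_mulDl : left_distributive hecke_mul +%R.
Proof. by move=> f g h; exact: linextD. Qed.

Fact hecke_mulDr : right_distributive hecke_mul +%R.
Proof.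
move=> f g h; rewrite /hecke_mul !linextE -big_split; apply: eq_bigr => w _ /=.
by rewrite foldr_linextD scalerDr.
Qed.

Fact hecke_mulZl c f g : c *: hecke_mul f g = hecke_mul (c *: f) g.
Proof. by rewrite /hecke_mul linextZ. Qed.

Fact hecke_mulZr c f g : c *: hecke_mul f g = hecke_mul f (c *: g).
Proof.
rewrite /hecke_mul !linextE scaler_sumr; apply: eq_bigr => w _ /=.
by rewrite foldr_linextZ !scalerA mulrC.
Qed.

Lemma hecke_mulTl w g : hecke_mul (T w) g = foldr mulTsl g w.
Proof. by rewrite /hecke_mul linextT. Qed.

Lemma mulTsl_map b : linear_map (mulTsl b).
Proof. exact: linext_map. Qed.

Lemma gen_cat b w : if (ell w < ell (gen b * w)%g)%N
  then val (gen b * w)%g = b :: w else val w = b :: (gen b * w)%g.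
Proof.
rewrite /ell /=; case: (word w) => //= c u.
by case: eqVneq => [->|_] /=; rewrite ?ltnn ?leqnn // ltnNge leqnSn.
Qed.

Lemma hecke_mul_mulTsl b f g : hecke_mul (mulTsl b f) g = mulTsl b (hecke_mul f g).
Proof.
have [LD LZ] := mulTsl_map b.
move: f; apply: linear_map_ext => [||w].
- by split=> [u v|c u]; rewrite ?LD ?LZ ?hecke_mulDl // -hecke_mulZl.
- by split=> [u v|c u]; rewrite ?hecke_mulDl -?hecke_mulZl ?LD ?LZ.
rewrite {1}/mulTsl linextT hecke_mulTl /mulTs; have := gen_cat b w.
case: ifP => _ wE; first by rewrite hecke_mulTl -[word _]/(val _) wE.
by rewrite hecke_mulDl -!hecke_mulZl !hecke_mulTl wE /= mulTsl_quad.
Qed.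

Fact hecke_mulA : associative hecke_mul.
Proof.
move=> f g h; move: f; apply: linear_map_ext => [||w].
- by split=> [u v|c u]; rewrite ?hecke_mulDl // -hecke_mulZl.
- by split=> [u v|c u]; rewrite ?hecke_mulDl // -!hecke_mulZl.
rewrite !hecke_mulTl; elim: (word w) => //= b u ->.
by rewrite hecke_mul_mulTsl.
Qed.

Fact hecke_mul1 : left_id hecke_one hecke_mul.
Proof. by move=> g; rewrite hecke_mulTl. Qed.

Fact hecke_mulr1 : right_id hecke_one hecke_mul.
Proof.
apply: linear_map_ext => [||w]; [|by split|].
  by split=> [u v|c u]; rewrite ?hecke_mulDl // -hecke_mulZl.
rewrite hecke_mulTl.
suff H u : alternating u -> foldr mulTsl hecke_one u = T (prod_gen u).
  by rewrite H ?prod_gen_word //; exact: wordP.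
elim: u => [_|b u IH bu]; first by rewrite /prod_gen big_nil.
have uA := path_sorted bu.
rewrite /= IH // /mulTsl linextT /mulTs.
have uE : word (prod_gen u) = u := congr1 val (prod_gen_word (Dihedral uA)).
rewrite /prod_gen big_cons -/(prod_gen u) ifT // /ell /= uE.
by rewrite (_ : lact b u = b :: u) //; exact: (@foldr_lact_cat [:: b]).
Qed.

Fact hecke_1_neq0 : hecke_one != 0.
Proof. by apply/eqP => /(congr1 (fun f : hecke => f@_1%g)) /eqP; rewrite coefT coef0 oner_eq0. Qed.

HB.instance Definition _ := GRing.Zmodule_isNzRing.Build hecke
  hecke_mulA hecke_mul1 hecke_mulr1 hecke_mulDl hecke_mulDr hecke_1_neq0.
HB.instance Definition _ := GRing.Lmodule_isLalgebra.Build LaurentPoly hecke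
  hecke_mulZl.
HB.instance Definition _ := GRing.Lalgebra_isAlgebra.Build LaurentPoly hecke
  hecke_mulZr.

Lemma ell_gen_le b (w : W) : (ell (gen b * w)%g <= (ell w).+1)%N.
Proof. by have := gen_cat b w; rewrite /ell; case: ifP => _ /(congr1 size) /= ->; lia. Qed.

Lemma ell_prod_gen_le u y : (ell (prod_gen u * y)%g <= size u + ell y)%N.
Proof.
elim: u => [|b u IH]; first by rewrite /prod_gen big_nil mul1g.
rewrite /prod_gen big_cons -/(prod_gen u) -mulgA.
exact: leq_trans (ell_gen_le _ _) _.
Qed.

Lemma foldr_T u y : ell (prod_gen u * y)%g = (size u + ell y)%N ->
  foldr mulTsl (T y) u = T (prod_gen u * y)%g.
Proof.
elim: u => [|b u IH]; first by rewrite /prod_gen big_nil mul1g.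
rewrite /prod_gen big_cons -/(prod_gen u) -mulgA => uy.
have le1 := ell_gen_le b (prod_gen u * y)%g.
have le2 := ell_prod_gen_le u y.
have {}uyE : ell (prod_gen u * y)%g = (size u + ell y)%N.
  by apply/eqP; rewrite eqn_leq le2; rewrite uy in le1.
by rewrite /= IH // /mulTsl linextT /mulTs uy uyE /= ltnSn.
Qed.

Lemma T_mul x y : ell (x * y)%g = (ell x + ell y)%N -> T x * T y = T (x * y)%g.
Proof.
rewrite [T x * T y]hecke_mulTl => xy.
by rewrite foldr_T prod_gen_word.
Qed.

Lemma T_quad b : (T (gen b) + 1) * (T (gen b) - q *: 1) = 0.
Proof.
have TT : T (gen b) * T (gen b) = (q - 1) *: T (gen b) + q *: 1.
  rewrite [T _ * T _]hecke_mulTl /= /mulTsl linextT /mulTs genK.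
  by [].
rewrite mulrBr mulrDl TT mul1r -scalerAr mulr1 scalerBl scale1r scalerDr.
by rewrite [X in X - _]addrAC subrK subrr.
Qed.

(** * Kazhdan-Lusztig bases and structure constants *)

Definition C (w : W) : hecke :=
  \sum_(y \in [set y | bruhat y w])
    ((-1) ^+ (ell w - ell y) * qh ((ell w)%:Z - (ell y)%:Z) * qh (- (ell y)%:Z)) *: T y.

Definition C' (w : W) : hecke :=
  qh (- (ell w)%:Z) *: \sum_(y \in [set y | bruhat y w]) T y.

Lemma coef_bruhat_sum (a : W -> LaurentPoly) w x :
  (\sum_(y \in [set y | bruhat y w]) a y *: T y)@_x =
  if `[< bruhat x w >] then a x else 0.
Proof.
rewrite fsbig_finite; last exact: finite_bruhat.
rewrite coef_sum; set s := fset_set _.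
have -> : \sum_(y <- s) (a y *: T y)@_x = \sum_(y <- s) (if y == x then a y else 0).
  by apply: eq_bigr => y _; rewrite coefZ coefT mulr_natr mulrb.
have sE : (x \in s) = `[< bruhat x w >].
  by rewrite in_fset_set ?inE //; exact: finite_bruhat.
rewrite -sE; case: ifP => xs; last first.
  by rewrite big_seq big1 // => y ys; case: eqP => // yx; rewrite -yx ys in xs.
by rewrite (big_fsetD1 x) //= eqxx big1_fset ?addr0 // => y;
   rewrite in_fsetD1 => /andP[/negbTE ->].
Qed.

Lemma coef_C w x : (C w)@_x =
  if `[< bruhat x w >] then
    (-1) ^+ (ell w - ell x) * qh ((ell w)%:Z - (ell x)%:Z) * qh (- (ell x)%:Z)
  else 0.
Proof. exact: coef_bruhat_sum. Qed.

Lemma coef_C' w x : (C' w)@_x =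
  if `[< bruhat x w >] then qh (- (ell w)%:Z) else 0.
Proof.
rewrite coefZ; under eq_fsbigr do rewrite -[T _]scale1r.
by rewrite coef_bruhat_sum; case: ifP; rewrite ?mulr1 ?mulr0.
Qed.

Lemma coef_C_self w : (C w)@_w = qh (- (ell w)%:Z).
Proof.
rewrite coef_C asboolT; last exact: Bruhat_refl.
by rewrite subnn subrr expr0 !mul1r.
Qed.

Lemma coef_C_eq0 w x : (ell w <= ell x)%N -> x != w -> (C w)@_x = 0.
Proof.
move=> wx xw; rewrite coef_C asboolF // => /bruhatP[/eqP|]; first by rewrite (negbTE xw).
by rewrite ltnNge wx.
Qed.

Lemma qhK n f : qh n * (qh (- n) * f) = f :> LaurentPoly.
Proof. by rewrite mulrA -qhD subrr qh0 mul1r. Qed.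

Lemma C_free g : linext C g = 0 -> g = 0.
Proof.
move=> Cg; apply: heckeP => w; rewrite coef0.
pose M := (\max_(x <- msupp g) ell x)%N.
have leM x : g@_x != 0 -> (ell x <= M)%N.
  by rewrite mcoeff_neq0 => xg; apply: leq_bigmax_seq.
have [m] := ubnP (M.+1 - ell w); elim: m w => // m IH w wm.
have [wM|wM] := leqP (ell w) M; last first.
  by apply/eqP/negPn/negP => /leM; rewrite leqNgt wM.
have: (linext C g)@_w = g@_w * (C w)@_w.
  rewrite linextE coef_sum; under eq_bigr do rewrite coefZ.
  have gw0 x : x != w -> g@_x * (C x)@_w = 0.
    move=> xw; have [xlew|wltx] := leqP (ell x) (ell w).
      by rewrite coef_C_eq0 ?mulr0 // eq_sym.
    by rewrite IH ?mul0r //; lia.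
  have [wg|wg] := boolP (w \in msupp g).
    rewrite (big_fsetD1 w) //= big1_fset ?addr0 // => x.
    by rewrite in_fsetD1 => /andP[xw _] _; exact: gw0.
  rewrite (mcoeff_outdom wg) mul0r big_seq big1 // => x xg; apply: gw0.
  by apply: contraNneq wg => <-.
rewrite Cg coef0 coef_C_self => /esym gw; rewrite -[LHS](qhK (ell w)%:Z).
by rewrite [_ * g@_w]mulrC gw mulr0.
Qed.

Lemma C_span u : exists g, u = linext C g.
Proof.
have spanT w : exists g, T w = linext C g.
  have [m] := ubnP (ell w); elim: m w => // m IH w wm.
  have /choice[G GE] x : exists g, (ell x < ell w)%N -> T x = linext C g.
    have [xw|_] := ltnP (ell x) (ell w); last by exists 0.
    by have [g gE] := IH x (leq_trans xw wm); exists g.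
  pose v := T w - qh (ell w)%:Z *: C w.
  exists (qh (ell w)%:Z *: T w + linext G v).
  rewrite linextD linextZ linextT.
  suff -> : linext C (linext G v) = v by rewrite addrC subrK.
  rewrite [linext G v]linextE linext_sum -[RHS]linext_id linextE.
  rewrite big_seq [RHS]big_seq; apply: eq_bigr => x; rewrite linextZ => xv.
  congr (_ *: _); apply/esym/GE; rewrite ltnNge; apply/negP => wx.
  move: xv; rewrite -mcoeff_neq0 coefD -scaleN1r !coefZ coefT.
  have [->|xw] := eqVneq x w.
    by rewrite coef_C_self -qhD subrr qh0 mulN1r subrr eqxx.
  by rewrite coef_C_eq0 // !mulr0 addr0 eqxx.
have /choice[G GE] := spanT.
exists (linext G u); rewrite [linext G u]linextE linext_sum -[LHS]linext_id linextE.
by apply: eq_bigr => w _; rewrite linextZ GE.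
Qed.

(* Coordinates in the basis [C], see [C_coordP]. *)
Definition C_coord (u : hecke) : {malg LaurentPoly[W]} :=
  xget 0 [set g : {malg LaurentPoly[W]} | u = \sum_(z <- msupp g) g@_z *: C z].

Lemma C_coordP u g : C_coord u = g <-> u = \sum_(z <- msupp g) g@_z *: C z.
Proof.
have uniq (g1 g2 : hecke) : linext C g1 = linext C g2 -> g1 = g2.
  move=> E; apply/eqP; rewrite -subr_eq0; apply/eqP/C_free.
  by rewrite linextD -scaleN1r linextZ scaleN1r E subrr.
have coordE : u = linext C (C_coord u).
  have [g0 ug0] := C_span u; rewrite linextE /C_coord.
  by apply: (@xgetPex _ _ [set g | u = \sum_(z <- msupp g) g@_z *: C z]);
     exists g0; rewrite /= -linextE.
split=> [<-|ug]; first by rewrite [LHS]coordE linextE.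
by apply: uniq; rewrite -coordE ug linextE.
Qed.

Definition hC (x y z : W) : LaurentPoly := (C_coord (C x * C y))@_z.

Definition distinguished : seq W := [:: 1%g; s0; s1].

(* Lusztig's [a]-function *)
Definition afun (w : W) : nat := (w != 1%g).

(* coefficient of [t_z] in [phi (C_x)] *)
Definition phi_coef (x z : W) : LaurentPoly :=
  \sum_(d <- distinguished | afun d == afun z) hC x d z.

(** * Completions

    Formal sums of the [b x * C_x], of the [b x * t_x] and of the [b x * C'_x]
    are represented by their families of coefficients [b]; the completions of
    [H] (basis [C]) and of [J] thus have the same underlying set [completeH]. *)

Definition completeH : set (W -> SeriesUp) :=
  [set b | forall N : nat, (0 < N)%N -> exists L : nat,
     forall x, (L <= ell x)%N -> forall i : int, i < N%:Z -> b x i = 0].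

Definition completeH' : set (W -> SeriesDown) :=
  [set b | forall N : nat, (0 < N)%N -> exists L : nat,
     forall x, (L <= ell x)%N -> forall i : int, - N%:Z < i -> b x i = 0].

(* The isomorphism [phi], taking coefficients in the basis [C] to coefficients
   in the basis [t]. *)
Definition phiH (b : W -> SeriesUp) : W -> SeriesUp :=
  fun z => lsum (fun x => b x * of_poly Ascending (phi_coef x z)).

(* The bijection [j] from [completeH'] to [completeH]. *)
Definition jmap (b : W -> SeriesDown) : W -> SeriesUp :=
  fun x => (-1) ^+ ell x * bar (b x).

Definition tJ (y : W) : W -> SeriesUp := fun x => (x == y)%:R.

(* the inverse of the bijection [phi \o j] on [completeH'] *)
Definition phij_inv : (W -> SeriesUp) -> (W -> SeriesDown) :=
  'pinv_(fun _ _ => 0) completeH' (phiH \o jmap).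

(* coefficient of [T_x] in the sum of the [a v * C'_v] *)
Definition T_coef (a : W -> SeriesDown) (x : W) : SeriesDown :=
  lsum (fun v => a v * of_poly Descending (C' v)@_x).

(* formal sum of the [c w * T_w] over the [w] satisfying [P], as the family of
   its coefficients *)
Definition T_sum (P : pred W) (c : W -> SeriesDown) : W -> SeriesDown :=
  fun w => if P w then c w else 0.

Notation qpow m := (qh (2 * m)).

(* Main.v *)
From mathcomp Require Import all_boot all_order all_algebra.
From mathcomp Require Import boolp classical_sets functions fsbigop monalg.
From mathcomp Require Import ring zify.
Require Import Defs.

Set Implicit Arguments.
Unset Strict Implicit.
Unset Printing Implicit Defensive.

Import Order.TTheory GRing.Theory Num.Theory.

Local Open Scope ring_scope.

(** Write [v] for [q^(1/2)].  Every element other than [1] is the alternating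
    word [chain c n] of some length [n > 0] starting with the letter [c], so the
    nontrivial elements form two half-lines, one for each first letter.

    The relation [phi_coef_chain] says that, along each half-line, the map [phi]
    acts on coefficients [b] by the second-order difference operator
    [b n + b (n+2) - (v + v^-1) * b (n+1)], the coefficient at [1] serving as
    boundary value.  It comes from the products of [C_x] with [C_s]
    ([C_mul_gen_descent], [C_mul_gen_ascent]): [C_x C_s] is
    [-(v + v^-1) C_x] if [x] ends in [s]; for the other [x <> 1] it is the sum of
    the [C_z] over the neighbours [z <> 1] of [x] on its half-line.

    The operator factors through [n |-> b (n+1) - v * b n].  For a solution of
    the homogeneous equation with [b 0 = 0], that first-order expression is
    [v^-n * b 1]; since it has to tend to [0] in the completion, [b 1 = 0] and
    the solution vanishes ([decaying_solution_eq0]).  So [phi] is injective, and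
    the inverse image of [t_y], with [l(y) = m], is the unique decaying solution
    with source at [y]: its coefficient at the element of length [n] on the
    half-line of [y] is [- (v^(m+n-1) + v^(m+n-3) + ... )], with [min(m,n)]
    terms, and it is [0] elsewhere ([preimage_coef_rec], [phij_inv_tJ]).

    It remains to pass to the basis [T].  The coefficient of [T_x] is a sum over
    the [n >= 1] with [x <= chain c n].  Exchanging it with the sum over the
    [min(m,n)] terms, the [k]-th inner sum is, up to a power of [v], the
    geometric series of the [(-1)^n q^-n] over all [n >= k] with
    [x <= chain c n].  These [n] are exactly those above one threshold
    ([threshold_le]), and the series is the [tail] starting there.  The three
    sums of the formula are the three possible values of the threshold: [l(x)]
    if [x] starts with [y_k], [l(x) + 1] if it does not and [l(x) >= k], and [k]
    if [l(x) < k] ([tail_threshold]). *)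

(** * Elements as alternating words *)

Fact alternating_traject c n : alternating (traject negb c n).
Proof.
case: n => // n; apply: sub_path (fpath_traject _ _ _) => a b /= /eqP <-.
by case: a.
Qed.

Definition chain (c : bool) (n : nat) : W := Dihedral (alternating_traject c n).

Lemma ell_chain c n : ell (chain c n) = n.
Proof. exact: size_traject. Qed.

Lemma chain0 c : chain c 0 = 1%g.
Proof. exact: val_inj. Qed.

Lemma chain1 c : chain c 1 = gen c.
Proof. exact: val_inj. Qed.

Lemma chain_head b (w : W) : w = chain (head b w) (ell w).
Proof.
apply: val_inj => /=; have := wordP w; rewrite /ell.
case: (word w) => //= c u cu; congr (_ :: _).
have /= := alternating_traject c (size u).+1.
by move/(alternating_inj cu); apply; rewrite size_traject.
Qed.

Lemma dihedral_cases (w : W) : w = 1%g \/ exists c n, w = chain c n.+1.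
Proof.
rewrite (chain_head false w); case: (ell w) => [|n]; first by left; rewrite chain0.
by right; exists (head false w), n.
Qed.

Lemma chain_eq c d m n :
  (chain c m == chain d n) = (m == n) && ((m == 0) || (c == d))%N.
Proof.
apply/eqP/andP => [E|[/eqP <- cd]].
  have mn : m = n by rewrite -(ell_chain c m) E ell_chain.
  rewrite mn; split=> //; move: E; rewrite -{}mn; case: m => //= m.
  by move/(congr1 val) => [->].
by case: eqP cd => [-> _|_ /= /eqP ->]; rewrite ?chain0.
Qed.

Lemma bruhat_chain c d m n :
  `[< bruhat (chain c m) (chain d n) >] =
  (m < n)%N || (m == n) && ((m == 0) || (c == d))%N.
Proof.
rewrite -chain_eq orbC; apply/asboolP/orP; rewrite bruhatP !ell_chain.
  by case=> [/eqP|]; [left | right].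
by case=> [/eqP|]; [left | right].
Qed.

Lemma chain_genS c n : (chain c n * gen (c (+) odd n))%g = chain c n.+1.
Proof.
apply: val_inj; rewrite [LHS]/= [RHS]/= -/(traject negb c n.+1).
have E : iter n negb c = c (+) odd n.
  by elim: n => [|n IH] /=; rewrite ?addbF // IH; case: c {IH}; case: odd.
rewrite trajectSr E -cats1; apply: foldr_lact_cat.
by rewrite cats1 -E -trajectSr; exact: alternating_traject.
Qed.

Lemma chain_genV c n : (chain c n.+1 * gen (c (+) odd n))%g = chain c n.
Proof. by rewrite -chain_genS -mulgA genK mulg1. Qed.

(** The first letter of the empty word is taken to be [b], so that [1] falls under
    the first case and [gen b] shortens the word in the second one. *)
Lemma chain_gen_cases b (u : W) : exists c n, u = chain c n /\
  ((b = c (+) odd n /\ (u * gen b)%g = chain c n.+1) \/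
   (exists2 k, n = k.+1 & b != c (+) odd n /\ (u * gen b)%g = chain c k)).
Proof.
exists (head b u), (ell u); split; first exact: chain_head.
have [bE|bN] := eqVneq b (head b u (+) odd (ell u)).
  by left; split=> //; rewrite -chain_genS -bE -chain_head.
right; case E: (ell u) bN => [|k] bN.
  have /eqP := E; rewrite ell_eq0 => /eqP u1.
  by move: bN; rewrite u1 /= addbF eqxx.
exists k => //; split=> //.
have bE : b = head b u (+) odd k.
  by move: bN; rewrite /=; move: (head b u) (odd k) => [] []; case: (b).
by rewrite -chain_genV -bE -E -chain_head.
Qed.

(** * Right multiplication by [C_s] *)

Lemma C_gen b : C (gen b) = qh (- 1) *: T (gen b) - qh 1 *: 1.
Proof.
apply: heckeP => w; rewrite coef_C coefD -scaleN1r !coefZ !coefT.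
rewrite -chain1; have [->|[c [n ->]]] := dihedral_cases w.
  rewrite -(chain0 b) bruhat_chain !chain_eq /= !ell_chain mulr0 add0r mulr1 mulN1r.
  by rewrite subr0 mulr1 mulN1r.
rewrite -(chain0 b) bruhat_chain !chain_eq /= !ell_chain !mulr0 addr0.
case: n => [|n]; rewrite ?mulr0 //= eq_sym.
by case: eqP => _; rewrite ?mulr0 // subrr expr0 qh0 !mul1r mulr1.
Qed.

Lemma T_mul_gen w b : T w * T (gen b) =
  if (ell w < ell (w * gen b)%g)%N then T (w * gen b)%g
  else (qh 2 - 1) *: T w + qh 2 *: T (w * gen b)%g.
Proof.
have [c [n [-> [[-> ->]|[k -> [bN wb]]]]]] := chain_gen_cases b w.
  by rewrite !ell_chain ltnSn T_mul chain_genS // !ell_chain addn1.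
rewrite wb !ell_chain ltnNge leqnSn /=.
have bE : b = c (+) odd k by move: bN; rewrite /=; case: b {wb}; case: c; case: odd.
rewrite bE -[T (chain c _)]/(T _) -(chain_genS c k) -T_mul; last first.
  by rewrite chain_genS !ell_chain addn1.
rewrite -mulrA; have /eqP := T_quad (c (+) odd k).
rewrite mulrBr mulrDl mul1r -scalerAr mulr1 subr_eq add0r => /eqP.
move/(canRL (addrK _)) => ->.
by rewrite mulrBr -scalerAr mulrDr mulr1 scalerDr scalerBl scale1r addrAC.
Qed.

Lemma mulg_ell_neq (u : W) b : ell (u * gen b)%g != ell u.
Proof.
apply/eqP => E; have := odd_ellM u (gen b).
by rewrite E /=; case: odd.
Qed.

Lemma mulg_gen_neq (u : W) b : (u * gen b)%g != u.
Proof. by apply: contraNneq (mulg_ell_neq u b) => ->. Qed.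

(** Right multiplication by [C_s = q^(-1/2) (T_s - q)] is a rank one operator on
    each plane spanned by [T_u] and [T_(us)], hence the difference of two
    coefficients. *)
Lemma coef_mul_C_gen (f : hecke) b u :
  (f * C (gen b))@_u =
  qh (if (ell u < ell (u * gen b)%g)%N then 1 else - 1) *
  (f@_(u * gen b)%g - f@_u).
Proof.
rewrite -(linext_id f) linextE.
apply: (big_ind (fun f : hecke => (f * C (gen b))@_u =
  qh (if (ell u < ell (u * gen b)%g)%N then 1 else - 1) *
  (f@_(u * gen b)%g - f@_u))).
- by rewrite mul0r !coef0 subr0 mulr0.
- by move=> g h; rewrite mulrDl !coefD => -> ->; ring.
move=> w _; rewrite -scalerAl !coefZ.
suff -> : (T w * C (gen b))@_u =
  qh (if (ell u < ell (u * gen b)%g)%N then 1 else - 1) *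
  ((T w)@_(u * gen b)%g - (T w)@_u) by ring.
have sK v : (v * gen b * gen b)%g = v by rewrite -mulgA genK mulg1.
have neq (v : W) : (v == v * gen b)%g = false by rewrite eq_sym (negbTE (mulg_gen_neq v b)).
have coefE v : (T w * C (gen b))@_v =
    qh (- 1) * (T w * T (gen b))@_v - qh 1 * (w == v)%:R.
  by rewrite C_gen mulrBr -!scalerAr mulr1 coefD -scaleN1r !coefZ coefT mulN1r.
have qq : qh (- 1) * qh 2 = qh 1 :> LaurentPoly by rewrite -qhD.
rewrite coefE T_mul_gen !coefT.
have [->|wu] := eqVneq w u.
  rewrite neq; case: ifP => _; rewrite ?coefD ?coefZ !coefT ?eqxx.
    by rewrite (negbTE (mulg_gen_neq u b)) mulr1n mulr0n; ring.
  rewrite (negbTE (mulg_gen_neq u b)) mulr1n mulr0n mulr1 mulr0 addr0 mulrBr qq.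
  by ring.
have [->|wus] := eqVneq w (u * gen b)%g.
  rewrite sK mulr1n mulr0n; have := mulg_ell_neq u b; rewrite neq_ltn.
  case: ltnP => [lt _|_ /= ->]; rewrite ?coefD ?coefZ !coefT ?eqxx.
    by rewrite [X in qh (if X then _ else _)]ltnNge ltnW // mulr1n; ring.
  rewrite (negbTE (mulg_gen_neq u b)) mulr1n mulr0n mulr0 add0r mulr1 qq.
  by ring.
have wsu : (w * gen b == u)%g = false.
  by apply: contra_neqF wus => /eqP <-; rewrite sK.
case: ifP => _; rewrite ?coefD ?coefZ !coefT wsu ?(negbTE wu) mulr0n; ring.
Qed.

(** The sign and the exponent of the coefficients of [C_x] depend separately on
    the two lengths; only the Bruhat order couples [x] and [u]. *)
Definition C_weight (l n : nat) : LaurentPoly :=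
  (-1) ^+ (l + n) * qh (l%:Z - 2 * n%:Z).

Lemma C_weightSl l n : C_weight l.+1 n = - qh 1 * C_weight l n.
Proof.
rewrite /C_weight addSn exprS (_ : l.+1%:Z - _ = 1 + (l%:Z - 2 * n%:Z)); last lia.
by rewrite (qhD _ 1) mulN1r !mulNr mulrCA.
Qed.

Lemma C_weightSr l n : C_weight l n.+1 = - qh (- 2) * C_weight l n.
Proof.
rewrite /C_weight addnS exprS (_ : _ - _ = - 2 + (l%:Z - 2 * n%:Z)); last lia.
by rewrite (qhD _ (- 2)) mulN1r !mulNr mulrCA.
Qed.

Lemma coef_C_weight x u :
  (C x)@_u = `[< bruhat u x >]%:R * C_weight (ell x) (ell u).
Proof.
rewrite coef_C; case: asboolP => [/bruhatP ux|_]; last by rewrite mul0r.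
have {}ux : (ell u <= ell x)%N by case: ux => [->|/ltnW].
rewrite mul1r /C_weight -mulrA -qhD; congr (_ * qh _); last by lia.
by rewrite -signr_odd oddB // -oddD signr_odd.
Qed.

Lemma qhNV n : qh n * qh (- n) = 1 :> LaurentPoly.
Proof. by rewrite -qhD subrr. Qed.

(** Passing from the shorter to the longer of [u] and [u s] multiplies the weight
    by [- q^-1], so the difference of [coef_mul_C_gen] becomes a sum in which the
    product is governed by two Bruhat comparisons alone. *)
Lemma coef_mul_C_genE x b u :
  let us := (u * gen b)%g in
  let lt := (ell u < ell us)%N in
  (C x * C (gen b))@_u = - C_weight (ell x) (ell u) *
  (qh 1 * `[< bruhat (if lt then u else us) x >]%:R +
   qh (- 1) * `[< bruhat (if lt then us else u) x >]%:R).
Proof.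
move=> us lt; rewrite coef_mul_C_gen !coef_C_weight -/us -/lt /lt {lt}.
have qhN2 : qh (- 2) = qh (- 1) * qh (- 1) :> LaurentPoly by rewrite -qhD.
rewrite /us; have [c [n [-> [[_ ->]|[k -> [_ ->]]]]]] := chain_gen_cases b u.
  rewrite !ell_chain ltnSn C_weightSr qhN2.
  by move: (_%:R) (_%:R) => X Y; ring: (qhNV 1).
rewrite !ell_chain ltnNge leqnSn /= C_weightSr qhN2.
by move: (_%:R) (_%:R) => X Y; ring: (qhNV 1).
Qed.

(** If [x s < x], then [u <= x] is equivalent to [u s <= x], so both Bruhat
    comparisons in [coef_mul_C_genE] agree. *)
Lemma C_mul_gen_descent d m :
  C (chain d m.+1) * C (gen (d (+) odd m)) =
  - (qh 1 + qh (- 1)) *: C (chain d m.+1).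
Proof.
apply: heckeP => u; rewrite coef_mul_C_genE coefZ coef_C_weight.
have [c [n [-> [[bE ->]|[k -> [bE ->]]]]]] := chain_gen_cases (d (+) odd m) u.
  rewrite !ell_chain ltnSn !bruhat_chain.
  have -> : ((n.+1 < m.+1) || (n.+1 == m.+1) && ((n.+1 == 0) || (c == d)) =
    ((n < m.+1) || (n == m.+1) && ((n == 0) || (c == d))))%N.
    by move: bE; case: c d => [] []; lia.
  by move: (_%:R) => X; ring.
rewrite !ell_chain ltnNge leqnSn /= !bruhat_chain.
have -> : ((k < m.+1) || (k == m.+1) && ((k == 0) || (c == d)) =
    ((k.+1 < m.+1) || (k.+1 == m.+1) && ((k.+1 == 0) || (c == d))))%N.
  by move: bE; rewrite /=; case: c d => [] []; lia.
by move: (_%:R) => X; ring.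
Qed.

(** If [x s > x], the smaller of [u] and [u s] lies below [x] iff [u <= x s].
    The larger one lies below [x] iff [u] lies below the other neighbour of
    [x]: it ends in [s], as that neighbour does and [x] does not.  No element
    ending in [s] lies below an [x] of length at most 1 that does not, whence
    the bound on [m]. *)
Lemma C_mul_gen_ascent d m :
  C (chain d m) * C (gen (d (+) odd m)) =
  C (chain d m.+1) + (if (1 < m)%N then C (chain d m.-1) else 0).
Proof.
apply: heckeP => u; rewrite coef_mul_C_genE coefD.
have -> : (if (1 < m)%N then C (chain d m.-1) else 0)@_u =
    ((1 < m)%N && `[< bruhat u (chain d m.-1) >])%:R * - (qh (- 1) * C_weight m (ell u)).
  case: m => [|[|m]] /=; rewrite ?coef0 ?mul0r // coef_C_weight ell_chain.
  rewrite [C_weight m.+2 _]C_weightSl; move: (_%:R) => X; ring: (qhNV 1).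
rewrite coef_C_weight.
have [c [n [-> [[bE ->]|[k -> [bE ->]]]]]] := chain_gen_cases (d (+) odd m) u.
  rewrite !ell_chain ltnSn !bruhat_chain C_weightSl.
  have -> : ((n.+1 < m) || (n.+1 == m) && ((n.+1 == 0) || (c == d)) =
    ((1 < m) && ((n < m.-1) || (n == m.-1) && ((n == 0) || (c == d)))))%N.
    by move: bE; case: c d => [] []; lia.
  have -> : ((n < m) || (n == m) && ((n == 0) || (c == d)) =
    ((n < m.+1) || (n == m.+1) && ((n == 0) || (c == d))))%N.
    by move: bE; case: c d => [] []; lia.
  by move: (_%:R) (_%:R) => X Y; ring.
rewrite !ell_chain ltnNge leqnSn /= !bruhat_chain C_weightSl.
have -> : ((k.+1 < m) || (k.+1 == m) && ((k.+1 == 0) || (c == d)) =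
    ((1 < m) && ((k.+1 < m.-1) || (k.+1 == m.-1) && ((k.+1 == 0) || (c == d)))))%N.
  by move: bE; rewrite /=; case: c d => [] []; lia.
have -> : ((k < m) || (k == m) && ((k == 0) || (c == d)) =
    ((k.+1 < m.+1) || (k.+1 == m.+1) && ((k.+1 == 0) || (c == d))))%N.
  by move: bE; rewrite /=; case: c d => [] []; lia.
by move: (_%:R) (_%:R) => X Y; ring.
Qed.

(** * The map [phi] as a difference operator *)

Lemma hC_coef x y z (g : hecke) : C x * C y = linext C g -> hC x y z = g@_z.
Proof. by rewrite /hC linextE => /C_coordP ->. Qed.

Lemma hC_ascent d m z :
  hC (chain d m) (gen (d (+) odd m)) z =
  (chain d m.+1 == z)%:R + ((1 < m)%N && (chain d m.-1 == z))%:R.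
Proof.
rewrite (hC_coef z (g := T (chain d m.+1) + (if (1 < m)%N then T (chain d m.-1) else 0))).
  by rewrite coefD coefT; case: ifP => _ //=; rewrite ?coefT ?coef0.
by rewrite C_mul_gen_ascent linextD linextT; case: ifP => _; rewrite ?linextT ?linext0.
Qed.

Lemma hC_descent d m z :
  hC (chain d m.+1) (gen (d (+) odd m)) z =
  - (qh 1 + qh (- 1)) * (chain d m.+1 == z)%:R.
Proof.
rewrite (hC_coef z (g := - (qh 1 + qh (- 1)) *: T (chain d m.+1))) ?coefZ ?coefT //.
by rewrite C_mul_gen_descent linextZ linextT.
Qed.

Lemma C_1 : C 1%g = 1.
Proof.
apply: heckeP => u; rewrite -[1 in RHS]/(T 1%g) coefT eq_sym.
have [->|u1] := eqVneq u 1%g; first by rewrite coef_C_self.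
by rewrite coef_C_eq0.
Qed.

Lemma phi_coef1 x : phi_coef x 1%g = (x == 1%g)%:R.
Proof.
rewrite /phi_coef /distinguished !big_cons big_nil /afun eqxx /= addr0.
by rewrite (hC_coef _ (g := T x)) ?coefT // linextT C_1 mulr1.
Qed.

(** For [x <> 1], one of the two generators is the last letter of [x] and gives
    the diagonal term, the other one gives the two neighbours.  The distinguished
    involution [1] does not contribute since [a(1) <> a(z)].  At [x = 1] both
    products [C_1 C_s = C_s] are present, one for each half-line; so [1] acts as
    the neighbour of both generators. *)
Lemma phi_coef_chain x c k :
  phi_coef x (chain c k.+1) =
  (x == chain c k)%:R + (x == chain c k.+2)%:R
  - (qh 1 + qh (- 1)) * (x == chain c k.+1)%:R.
Proof.
have sumE b : phi_coef x (chain c k.+1) =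
    hC x (gen b) (chain c k.+1) + hC x (gen (~~ b)) (chain c k.+1).
  rewrite /phi_coef /distinguished !big_cons big_nil /afun eqxx -!ell_eq0.
  rewrite ell_chain; move: (hC x) => h; rewrite /= addr0.
  by case: b => //=; rewrite addrC.
have [xE|[d [m xE]]] := dihedral_cases x.
  have h b : hC x (gen b) (chain c k.+1) = (chain b 1 == chain c k.+1)%:R.
    by have := hC_ascent b 0 (chain c k.+1); rewrite addbF chain0 xE addr0.
  rewrite (sumE c) !h xE -(chain0 c) !chain_eq eqxx.
  have -> : (~~ c == c) = false by case: (c).
  by case: k {sumE h} => [|k]; rewrite /= !mulr0n ?mulr1n mulr0 subr0.
rewrite (sumE (d (+) odd m)) -addbN.
have -> : d (+) ~~ odd m = d (+) odd m.+1 by [].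
rewrite xE hC_descent hC_ascent addrC mulNr; congr (_ - _).
by rewrite !chain_eq !eqSS; case: m {xE}.
Qed.

Lemma lcoef_sum k (I : Type) (r : seq I) (P : pred I) (F : I -> laurent k) p :
  (\sum_(i <- r | P i) F i) p = \sum_(i <- r | P i) F i p.
Proof.
by apply: (big_morph (fun f : laurent k => f p)) => // f g; rewrite lcoefD.
Qed.

Lemma lsum_coef k (I : choiceType) (F : I -> laurent k) (S : laurent k) :
  (forall p, (\sum_(i \in [set: I]%classic) F i p)%R = S p) -> lsum F = S.
Proof. by move=> FS; rewrite /lsum (funext FS) valKd. Qed.

Lemma lsum_seq k (I : choiceType) (F : I -> laurent k) (s : seq I) :
  uniq s -> (forall i, i \notin s -> F i = 0) -> lsum F = \sum_(i <- s) F i.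
Proof.
move=> us Fs; apply: lsum_coef => p; rewrite lcoef_sum; apply: fsum_seq us _ => i.
by apply: contraNT => /Fs ->; rewrite lcoef0.
Qed.

Lemma of_polyD k f g : of_poly k (f + g) = of_poly k f + of_poly k g.
Proof. by apply: laurent_eqP => i; rewrite lcoefD [LHS]lcoefD. Qed.

Lemma of_polyN k f : of_poly k (- f) = - of_poly k f.
Proof. by apply: laurent_eqP => i; rewrite lcoefN [LHS]lcoefN. Qed.

Lemma of_polyM k f g : of_poly k (f * g) = of_poly k f * of_poly k g.
Proof. by apply: laurent_eqP => i; rewrite lcoefM [LHS]lcoefM. Qed.

Lemma of_poly_qh k n : of_poly k (qh n) = qh n.
Proof. by apply: laurent_eqP => i; rewrite lcoef_qh [LHS]lcoef_qh. Qed.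

Lemma of_poly_bool k (b : bool) : of_poly k b%:R = b%:R.
Proof. by case: b; [exact: of_poly_qh | apply: laurent_eqP]. Qed.

Lemma phiH1 b : phiH b 1%g = b 1%g.
Proof.
rewrite /phiH (@lsum_seq _ _ _ [:: 1%g]) // => [|x].
  by rewrite big_seq1 phi_coef1 of_poly_bool eqxx mulr1.
by rewrite mem_seq1 phi_coef1 of_poly_bool => /negbTE ->; rewrite mulr0.
Qed.

Lemma phiH_chain b c n : phiH b (chain c n.+1) =
  b (chain c n) + b (chain c n.+2) - (qh 1 + qh (- 1)) * b (chain c n.+1).
Proof.
have phiE x : of_poly Ascending (phi_coef x (chain c n.+1)) =
    (x == chain c n)%:R + (x == chain c n.+2)%:R
    - (qh 1 + qh (- 1)) * (x == chain c n.+1)%:R.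
  by rewrite phi_coef_chain !(of_polyD, of_polyN, of_polyM, of_poly_qh, of_poly_bool).
rewrite /phiH (@lsum_seq _ _ _ [:: chain c n; chain c n.+1; chain c n.+2]).
- rewrite !big_cons big_nil !phiE !chain_eq !eqxx !orbT !andbT.
  have [e1 e2] : (n == n.+1) = false /\ (n == n.+2) = false by lia.
  by rewrite [n.+2 == n]eq_sym [n.+1 == n]eq_sym e1 e2 !mulr0n !mulr1n; ring.
- by rewrite /= !inE !chain_eq; lia.
move=> x; rewrite !inE !negb_or => /and3P[/negbTE x0 /negbTE x1 /negbTE x2].
by rewrite phiE x0 x1 x2 !mulr0n mulr0 addr0 subr0 mulr0.
Qed.

(** * Inverting the difference operator *)

(** The first-order factor of the difference operator, see [defectE]. *)
Definition defect k (d : nat -> laurent k) n := d n.+1 - qh 1 * d n.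

Lemma defectE k (d : nat -> laurent k) n :
  d n + d n.+2 - (qh 1 + qh (- 1)) * d n.+1 =
  defect d n.+1 - qh (- 1) * defect d n.
Proof.
have vV : qh 1 * qh (- 1) = 1 :> laurent k by rewrite -qhD subrr.
by rewrite /defect; ring: vV.
Qed.

(** The [defect] of a solution is [v^-n * d 1], that is [d 1 = v^n * defect d n].
    Each coefficient of the right-hand side vanishes for large [n], by decay. *)
Lemma decaying_solution_eq0 (d : nat -> SeriesUp) (L : nat) :
  d 0 = 0 -> (forall n, d n + d n.+2 - (qh 1 + qh (- 1)) * d n.+1 = 0) ->
  (forall n, (L <= n)%N -> forall i : int, i < 1 -> d n i = 0) ->
  forall n, d n = 0.
Proof.
move=> d0 d_rec d_decay.
have defectS n : defect d n = qh (- n%:Z) * d 1%N.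
  elim: n => [|n IH]; first by rewrite /defect d0 mulr0 subr0 oppr0 qh0 mul1r.
  have /eqP := d_rec n; rewrite defectE subr_eq0 IH => /eqP ->.
  by rewrite mulrA -qhD; congr (qh _ * _); lia.
have d1 : d 1%N = 0.
  apply: laurent_eqP => i; rewrite lcoef0.
  (* [d] has decayed from [n] on, and [i - n] is less than 1 *)
  pose n := (L + absz i)%N.
  have <- : qh n%:Z * defect d n = d 1%N.
    by rewrite defectS mulrA -qhD subrr qh0 mul1r.
  rewrite lcoef_qhM /defect lcoefD lcoefN lcoef_qhM !d_decay ?subr0 // /n; lia.
elim=> [//|n dn].
by have /eqP := defectS n; rewrite /defect d1 dn !mulr0 subr0 => /eqP.
Qed.

Lemma phiH_inj : {in completeH &, injective phiH}.
Proof.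
move=> b1 b2 /set_mem H1 /set_mem H2 E.
have b0 : b1 1%g = b2 1%g by rewrite -[LHS]phiH1 -[RHS]phiH1 E.
apply/funext => x; rewrite (chain_head false x); move: (head _ _) (ell x) => c.
have [L1 HL1] := H1 1%N isT; have [L2 HL2] := H2 1%N isT.
suff d0 n : b1 (chain c n) - b2 (chain c n) = 0.
  by move=> n; apply/eqP; rewrite -subr_eq0 d0.
move: n; apply: (@decaying_solution_eq0 _ (L1 + L2)%N).
- by rewrite chain0 b0 subrr.
- move=> n; have := congr1 (fun b => b (chain c n.+1)) E; rewrite !phiH_chain => /eqP.
  rewrite -subr_eq0 => /eqP <-; ring.
move=> n Ln i i1; rewrite lcoefD lcoefN HL1 ?HL2 ?subr0 // ell_chain; lia.
Qed.

(** The fundamental solution with source at [m]: [- v^max(m,n)] times the quantum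
    integer of [min(m,n)], that is [v^(N-1) + v^(N-3) + ... + v^(1-N)] for
    [N = min(m,n)]. *)
Definition preimage_coef k (m n : nat) : laurent k :=
  - \sum_(1 <= j < (minn m n).+1) qh ((m + n).+1%:Z - 2 * j%:Z).

(** The step from [n] to [n+1] multiplies the sum by [v] and, as long as [n < m],
    adds one term: the [defect] is the opposite of that new term. *)
Lemma defect_preimage_coef k m n :
  defect (preimage_coef k m) n = - ((n < m)%N%:R * qh (m%:Z - n%:Z)).
Proof.
rewrite /defect /preimage_coef mulrN opprK mulr_sumr.
have -> : \sum_(1 <= j < (minn m n).+1) qh 1 * qh ((m + n).+1%:Z - 2 * j%:Z) =
    \sum_(1 <= j < (minn m n).+1) qh ((m + n.+1).+1%:Z - 2 * j%:Z) :> laurent k.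
  by apply: eq_bigr => j _; rewrite -qhD; congr qh; lia.
case: ltnP => nm.
  rewrite (minn_idPr nm) big_nat_recr //= mul1r opprD addrAC addNr add0r.
  by congr (- qh _); lia.
by rewrite (minn_idPl (leqW nm)) addNr mul0r oppr0.
Qed.

Lemma preimage_coef_rec k m n :
  let d := preimage_coef k m in
  d n + d n.+2 - (qh 1 + qh (- 1)) * d n.+1 = (n.+1 == m)%:R.
Proof.
move=> d; rewrite (defectE d) !defect_preimage_coef mulrN opprK mulrCA -qhD.
have -> : - 1 + (m%:Z - n%:Z) = m%:Z - n.+1%:Z by lia.
rewrite [(n < m)%N]leq_eqVlt; case: eqP => [<-|_] /=; last by rewrite addNr.
by rewrite ltnn subrr qh0 mul1r mul0r oppr0 add0r.
Qed.

(** The coefficients of [(phi o j)^-1 (t_y)] for [y = chain c m]. *)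
Definition preimage (c : bool) (m : nat) (w : W) : SeriesDown :=
  if w == chain c (ell w) then
    - ((-1) ^+ ell w *
       \sum_(1 <= j < (minn m (ell w)).+1) qh (2 * j%:Z - (m + ell w).+1%:Z))
  else 0.

Lemma jmap_preimage c m w : jmap (preimage c m) w =
  if w == chain c (ell w) then preimage_coef Ascending m (ell w) else 0.
Proof.
apply: laurent_eqP => i; rewrite lcoef_signM /bar /= /flip /preimage.
case: ifP => _; last by rewrite !lcoef0 mulr0.
rewrite !lcoefN lcoef_signM mulrN signrMK !lcoef_sum; congr (- _).
by apply: eq_bigr => j _; rewrite !lcoef_qh; congr (_ : bool)%:R; lia.
Qed.

Lemma jmap_inj : injective jmap.
Proof.
move=> a b E; apply/funext => w; apply: laurent_eqP => i.
have /(congr1 (fun f : SeriesUp => f (- i))) := congr1 (fun f => f w) E.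
rewrite /jmap !lcoef_signM /bar /= /flip opprK => /(congr1 (fun z => (-1) ^+ ell w * z)).
by rewrite !signrMK.
Qed.

Lemma jmap_completeH a : completeH' a -> completeH (jmap a).
Proof.
move=> Ha N N0; have [L HL] := Ha N N0; exists L => x Lx i iN.
rewrite lcoef_signM /bar /= /flip HL ?mulr0 //; lia.
Qed.

Lemma preimage_completeH' c m : completeH' (preimage c m).
Proof.
move=> N _; exists (N + m)%N => x Lx i iN; rewrite /preimage.
case: ifP => _; last exact: lcoef0.
rewrite lcoefN lcoef_signM lcoef_sum big_nat_cond big1 ?mulr0 ?oppr0 // => j.
rewrite andbT => jm; rewrite lcoef_qh; case: eqP => //; lia.
Qed.

Lemma phiH_preimage c m : (0 < m)%N -> phiH (jmap (preimage c m)) = tJ (chain c m).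
Proof.
move=> m0; apply/funext => x; rewrite /tJ.
have at1 : jmap (preimage c m) 1%g = 0.
  rewrite jmap_preimage -(chain0 c) ell_chain eqxx /preimage_coef minn0.
  by rewrite big_geq ?oppr0.
have [->|[d [n ->]]] := dihedral_cases x.
  by rewrite phiH1 at1 -(chain0 c) chain_eq; case: (m) m0.
rewrite phiH_chain; have [->|dc] := eqVneq d c.
  rewrite !jmap_preimage !ell_chain !eqxx preimage_coef_rec chain_eq eqxx orbT.
  by rewrite andbT.
have off j : jmap (preimage c m) (chain d j) = 0.
  case: j => [|j]; first by rewrite chain0.
  by rewrite jmap_preimage ell_chain chain_eq (negbTE dc) andbF.
by rewrite !off chain_eq (negbTE dc) andbF mulr0 subr0 addr0.
Qed.

Lemma phij_inv_tJ c m : (0 < m)%N -> phij_inv (tJ (chain c m)) = preimage c m.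
Proof.
move=> m0; rewrite -phiH_preimage // /phij_inv.
have inj : {in completeH' &, injective (phiH \o jmap)}.
  move=> a b /set_mem Ha /set_mem Hb /= E; apply/jmap_inj/phiH_inj => //.
    exact/mem_set/jmap_completeH.
  exact/mem_set/jmap_completeH.
exact: (pinvKV (fun _ _ => 0) inj (mem_set (preimage_completeH' c m))).
Qed.

(** * The coefficients in the basis [T] *)

(** Only the tails [U n] enter, so that no rearrangement of an infinite sum is
    needed. *)
Lemma lsum_telescope_chain (F : W -> SeriesDown) c (U : nat -> SeriesDown) :
  (forall w, w != chain c (ell w) -> F w = 0) ->
  (forall n, F (chain c n) = U n - U n.+1) ->
  (forall p, exists M : nat, forall n, (M <= n)%N -> U n p = 0) ->
  lsum F = U 0.
Proof.
move=> F_off FU U0; apply: lsum_coef => p; have [M UM] := U0 p.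
rewrite (@fsum_seq _ _ [seq chain c n | n <- iota 0 M]).
- rewrite big_map -[M in iota 0 M]subn0 -/(index_iota 0 M).
  under eq_bigr do rewrite FU lcoefD lcoefN -opprB.
  by rewrite sumrN (telescope_sumr (fun n => U n p)) // opprB (UM M) ?subr0.
- rewrite map_inj_uniq ?iota_uniq // => a b /eqP.
  by rewrite chain_eq => /andP[/eqP].
move=> w Fw; have [wc|/F_off w0] := eqVneq w (chain c (ell w)); last first.
  by rewrite w0 lcoef0 eqxx in Fw.
apply/mapP; exists (ell w) => //; rewrite mem_iota /= add0n ltnNge.
by apply: contra Fw => Mw; rewrite wc FU lcoefD lcoefN !UM ?subr0 ?eqxx // leqW.
Qed.

(** The sum of the [(-1)^n q^-n] over [n >= N], see [tail_sub]. *)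
Definition tail (N : nat) : SeriesDown := (-1) ^+ N * over_1Dq (qpow (- N%:Z + 1)).

Lemma tail_sub N : tail N - tail N.+1 = (-1) ^+ N * qpow (- N%:Z).
Proof.
rewrite /tail exprS -(over_1DqK (qpow (- N%:Z))) /over_1Dq.
have -> : - N.+1%:Z + 1 = - N%:Z by lia.
have -> : qh (2 * (- N%:Z + 1)) = qh 2 * qh (2 * - N%:Z) :> SeriesDown.
  by rewrite -qhD; congr qh; lia.
move: ((-1) ^+ N) => e; ring.
Qed.

Lemma tail_small n (p : int) : (absz p < n)%N -> tail n p = 0.
Proof.
move=> pn; rewrite lcoef_signM /over_1Dq -!mulrA !lcoef_qhM q_over_1DqE.
by case: ifP => [/andP[]|]; rewrite ?mulr0 //; lia.
Qed.

(** The least [n >= k] such that [x <= chain c n], see [threshold_le]. *)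
Definition threshold c x k := maxn k (ell x + (x != chain c (ell x))).

Lemma threshold_le c x k n :
  (threshold c x k <= n)%N = (k <= n)%N && `[< bruhat x (chain c n) >].
Proof.
rewrite geq_max; congr (_ && _); rewrite (chain_head c x) ell_chain.
move: (head c x) (ell x) => d l; rewrite bruhat_chain chain_eq eqxx /=; lia.
Qed.

(** The [n]-th summand of the series is the difference of two consecutive values
    of [U]: its [k]-th part is nonzero iff [n] has reached the threshold, and
    replacing [n] by its maximum with the threshold makes [U] constant before. *)
Lemma T_coef_preimage c m x : T_coef (preimage c m) x =
  \sum_(1 <= k < m.+1) - qh (2 * k%:Z - m.+1%:Z) * tail (threshold c x k).
Proof.
pose U n : SeriesDown :=
  \sum_(1 <= k < m.+1) - qh (2 * k%:Z - m.+1%:Z) * tail (maxn n (threshold c x k)).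
transitivity (U 0%N); last by apply: eq_bigr => k _; rewrite max0n.
apply: (@lsum_telescope_chain _ c) => [w wc|n|p].
- by rewrite /preimage (negbTE wc) mul0r.
- rewrite /preimage ell_chain eqxx coef_C' ell_chain /U -sumrB.
  rewrite (@big_nat_widen _ _ _ _ _ m.+1); last by rewrite ltnS geq_minl.
  rewrite big_mkcond /= mulr_sumr -sumrN mulr_suml [LHS]big_nat [RHS]big_nat.
  apply: eq_bigr => k /andP[k0 km]; rewrite -mulrBr ltnS leq_min -ltnS km /=.
  have := threshold_le c x k n; case: (leqP _ n) => [Nn|nN].
    rewrite !(maxn_idPl _) ?(leqW Nn) // => /esym/andP[-> ->].
    rewrite of_poly_qh tail_sub.
    have -> : qh (2 * k%:Z - (m + n).+1%:Z) = qh (2 * k%:Z - m.+1%:Z) * qh (- n%:Z) :> SeriesDown.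
      by rewrite -qhD; congr qh; lia.
    have -> : qh (2 * - n%:Z) = qh (- n%:Z) * qh (- n%:Z) :> SeriesDown.
      by rewrite -qhD; congr qh; lia.
    by move: ((-1) ^+ n) => e; ring.
  rewrite !(maxn_idPr _) ?(ltnW nN) // subrr mulr0.
  have of_poly0 : of_poly Descending 0 = 0 by apply: laurent_eqP.
  by case: leqP => _ /=; [move=> <- | move=> _]; rewrite ?of_poly0 ?mulr0 ?oppr0 ?mul0r.
(* the powers of [q^(1/2)] in front of the tails shift [p] by less than [m.+1] *)
exists (absz p + m.+2)%N => n pn; rewrite lcoef_sum big_nat big1 // => k /andP[k0 km].
rewrite mulNr lcoefN lcoef_qhM tail_small ?oppr0 // leq_max; apply/orP; left.
lia.
Qed.

(** In a reduced word each letter lengthens the product of the letters after it,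
    and then it is prepended to the word of that product. *)
Lemma word_prod_gen u : ell (prod_gen u) = size u -> word (prod_gen u) = u.
Proof.
elim: u => [|b u IH]; first by rewrite /prod_gen big_nil.
have le_u := ell_prod_gen u; have le_bu := ell_gen_le b (prod_gen u).
have -> : prod_gen (b :: u) = (gen b * prod_gen u)%g by rewrite /prod_gen big_cons.
move=> E; have uE : ell (prod_gen u) = size u by move: E le_u le_bu => /=; lia.
have := gen_cat b (prod_gen u); rewrite E uE /= ltnSn => ->.
by rewrite IH.
Qed.

Lemma starts_with_chain w c k : (0 < k)%N ->
  starts_with w (chain c k) = (k <= ell w)%N && (w == chain c (ell w)).
Proof.
move=> k0; apply/eqP/andP => [E|[kw /eqP wE]].
  pose z := ((chain c k)^-1 * w)%g.
  have wz : w = prod_gen (chain c k ++ z).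
    by rewrite /prod_gen big_cat -!/(prod_gen _) !prod_gen_word /= /z mulVKg.
  have wordw : word w = chain c k ++ z.
    by rewrite wz word_prod_gen // -wz size_cat.
  split; first by rewrite E ell_chain leq_addr.
  apply/eqP; rewrite [LHS](chain_head c) wordw.
  by case: (k) k0.
have zA : alternating (drop k w) by apply/drop_sorted/wordP.
have wz : w = (chain c k * Dihedral zA)%g.
  apply: val_inj => /=.
  have tE : traject negb c k = take k w.
    by rewrite wE /= take_traject.
  by rewrite tE foldr_lact_cat cat_take_drop //; exact: wordP.
by rewrite {2}wz mulKg ell_chain /ell size_drop subnKC.
Qed.

Lemma tail_threshold c k x : (0 < k)%N ->
  let y := chain c k in
  tail (threshold c x k) =
    T_sum (fun w => starts_with w y)
      (fun w => (-1) ^+ ell w * over_1Dq (qpow (- (ell w)%:Z + 1))) x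
    + T_sum (fun w => ~~ starts_with w y && (k <= ell w)%N)
      (fun w => (-1) ^+ (ell w).+1 * over_1Dq (qpow (- (ell w)%:Z))) x
    + (-1) ^+ k * over_1Dq (qpow (- k%:Z + 1)) *
      T_sum (fun w => ~~ starts_with w y && (ell w < k)%N) (fun=> 1) x.
Proof.
move=> k0 y; rewrite /T_sum /y starts_with_chain // /threshold -/(tail k) -/(tail (ell x)).
have -> : (-1) ^+ (ell x).+1 * over_1Dq (qpow (- (ell x)%:Z)) = tail (ell x).+1.
  by rewrite /tail; congr (_ * over_1Dq (qh (2 * _))); lia.
case: (leqP k (ell x)) => kx /=; case: eqP => _ /=.
- by rewrite addn0 (maxn_idPr kx) mulr0 !addr0.
- by rewrite addn1 (maxn_idPr (leqW kx)) mulr0 addr0 add0r.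
- by rewrite addn0 (maxn_idPl (ltnW kx)) mulr1 !add0r.
- by rewrite addn1 (maxn_idPl kx) mulr1 !add0r.
Qed.

Theorem corollary1 (n : nat) (i : n.-tuple bool) (y : W) :
  (0 < n)%N -> y = prod_gen i -> ell y = n ->
  let y_ (k : nat) : W := prod_gen (take k i) in
  forall x : W,
    - qh (1 - n%:Z) * T_coef (phij_inv (tJ y)) x =
    \sum_(1 <= k < n.+1) qpow (k%:Z - n%:Z) *
      (T_sum (fun w => starts_with w (y_ k))
         (fun w => (-1) ^+ ell w * over_1Dq (qpow (- (ell w)%:Z + 1))) x
       + T_sum (fun w => ~~ starts_with w (y_ k) && (k <= ell w)%N)
         (fun w => (-1) ^+ (ell w).+1 * over_1Dq (qpow (- (ell w)%:Z))) x
       + (-1) ^+ k * over_1Dq (qpow (- k%:Z + 1)) *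
         T_sum (fun w => ~~ starts_with w (y_ k) && (ell w < k)%N)
         (fun=> 1) x).
Proof.
move=> n0 yE yn y_ x.
have [c yc] : exists c, y = chain c n.
  by exists (head false y); rewrite [LHS](chain_head false) yn.
have iE : tval i = traject negb c n.
  by rewrite -[RHS]/(word (chain c n)) -yc yE word_prod_gen // -yE yn size_tuple.
rewrite yc phij_inv_tJ // T_coef_preimage mulr_sumr big_nat [RHS]big_nat.
apply: eq_bigr => k /andP[k0 kn].
have -> : y_ k = chain c k.
  by rewrite /y_ iE take_traject // -[RHS]prod_gen_word.
rewrite -tail_threshold // mulrA mulrNN -qhD; congr (qh _ * _); lia.
Qed.
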